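(* The parameterized reachability problem (PRP) for constraints in CC is NP-complete: given a process $\mathcal{P}=\langle Q,\Sigma,R,Q_0\rangle$ and a constraint $\varphi$ in CC over $\mathcal{P}$, deciding whether $\mathcal{P}\models\Diamond\varphi$ is NP-complete.
   Context: A process is a tuple $\mathcal{P}=\langle Q,\Sigma,R,Q_0\rangle$ where $Q$ is a finite set of control states, $\Sigma$ a finite alphabet of messages, $Q_0\subseteq Q$ the initial control states, and $R$ a finite set of rules of three kinds: broadcast rules $\langle q,!!a,q'\rangle$, reception rules $\langle q,??a,q'\rangle$, and internal rules $\langle q,\tau,q'\rangle$. The network $\mathit{MAHN}(\mathcal{P})$ has as configurations finite undirected graphs $\gamma=\langle V,E,L\rangle$ with $L:V\to Q$; initial configurations are all such graphs (any size, any topology) with all labels in $Q_0$. Transitions: (internal) a node labelled $q$ with rule $\langle q,\tau,q'\rangle$ changes to $q'$; (broadcast) a node labelled $q$ with rule $\langle q,!!a,q'\rangle$ changes to $q'$ and simultaneously each neighbour labelled $p$ having some rule $\langle p,??a,p'\rangle$ changes to such a $p'$ (nondeterministically chosen), other nodes unchanged; (movement) the edge set may be changed arbitrarily with labels unchanged. Constraints in CC over $\mathcal{P}$ are boolean combinations of atoms $\#q\geq1$ and $\#q=0$ ($q\in Q$); a configuration satisfies $\#q\geq1$ iff some node is labelled $q$, and $\#q=0$ iff no node is labelled $q$. $\mathcal{P}\models\Diamond\varphi$ means there exist an initial configuration $\gamma_0$ and a configuration $\gamma$ with $\gamma_0\rightarrow^\ast\gamma$ and $\gamma\models\varphi$.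 Input size is the size of $\mathcal{P}$ plus the size of $\varphi$. *)

(* Defs.v *)
From Stdlib Require Import Relation_Operators.
From HB Require Import structures.
From mathcomp Require Import all_boot all_order all_algebra.

Set Implicit Arguments.
Unset Strict Implicit.
Unset Printing Implicit Defensive.

(** * Processes and mobile ad hoc networks *)

Inductive action (S : Type) : Type :=
  | Broadcast of S
  | Receive of S
  | Internal.
Arguments Internal {S}.

Definition action_sum (S : Type) (x : action S) : option (S + S) :=
  match x with
  | Broadcast a => Some (inl a)
  | Receive a => Some (inr a)
  | Internal => None
  end.

Definition sum_action (S : Type) (x : option (S + S)) : action S :=
  match x with
  | Some (inl a) => Broadcast a
  | Some (inr a) => Receive a
  | None => Internal
  end.

Lemma action_sumK (S : Type) : cancel (@action_sum S) (@sum_action S).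
Proof. by case. Qed.

HB.instance Definition _ (S : finType) :=
  Finite.copy (action S) (can_type (@action_sumK S)).

(* The triple [(q, x, q')] is the rule from [q] to [q'] with action [x]. *)
Definition rule (Q S : Type) : Type := (Q * action S * Q)%type.

Record process (Q S : finType) : Type := Process {
  rules : {set rule Q S};
  initials : {set Q}
}.

(* Configurations with node set [V]: no transition changes the node set, so
   [V] is a parameter. *)
Record config (Q V : finType) : Type := Config {
  edge : rel V;
  edge_sym : symmetric edge;
  edge_irr : irreflexive edge;
  label : V -> Q
}.

Inductive transition (Q S V : finType) (P : process Q S) (g g' : config Q V) :
    Prop :=
  | TransInternal (v : V) of
      (label g v, Internal, label g' v) \in rules P &
      (forall u, u != v -> label g' u = label g u) &
      edge g' =2 edge g
  | TransBroadcast (v : V) (a : S) of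
      (label g v, Broadcast a, label g' v) \in rules P &
      (forall u, edge g v u ->
         if [exists p', (label g u, Receive a, p') \in rules P]
         then (label g u, Receive a, label g' u) \in rules P
         else label g' u == label g u) &
      (forall u, u != v -> ~~ edge g v u -> label g' u = label g u) &
      edge g' =2 edge g
  | TransMove of label g' =1 label g.

Inductive constraint (Q : Type) : Type :=
  | AtLeastOne of Q
  | Zero of Q
  | Not of constraint Q
  | And of constraint Q & constraint Q
  | Or of constraint Q & constraint Q.

Fixpoint satisfies (Q V : finType) (g : config Q V) (phi : constraint Q) :
    bool :=
  match phi with
  | AtLeastOne q => [exists v, label g v == q]
  | Zero q => [forall v, label g v != q]
  | Not psi => ~~ satisfies g psi
  | And psi1 psi2 => satisfies g psi1 && satisfies g psi2
  | Or psi1 psi2 => satisfies g psi1 || satisfies g psi2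
  end.

Definition reaches (Q S : finType) (P : process Q S) (phi : constraint Q) :
    Prop :=
  exists (V : finType) (g0 g : config Q V),
    [/\ forall v, label g0 v \in initials P,
        clos_refl_trans (config Q V) (transition P) g0 g &
        satisfies g phi].

(** * Instances and their encoding as words *)

(* The finite sets of control states and of messages are represented by
   initial segments of [nat]; [R] and [Q0] are given by listing their
   elements. *)
Record instance : Type := Instance {
  nstates : nat;
  nmessages : nat;
  rule_list : seq (rule 'I_nstates 'I_nmessages);
  initial_list : seq 'I_nstates;
  inst_constraint : constraint 'I_nstates
}.

Definition inst_process (I : instance) :
    process 'I_(nstates I) 'I_(nmessages I) :=
  Process [set r in rule_list I] [set q in initial_list I].

Inductive token : Type :=
  | TOne | TEnd | TBroadcast | TReceive | TInternal | TInitial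
  | TAtLeastOne | TZero | TNot | TAnd | TOr.

Definition tokens : seq token :=
  [:: TOne; TEnd; TBroadcast; TReceive; TInternal; TInitial;
      TAtLeastOne; TZero; TNot; TAnd; TOr].

Definition token_ord (t : token) : 'I_11 :=
  inord match t with
        | TOne => 0 | TEnd => 1 | TBroadcast => 2 | TReceive => 3
        | TInternal => 4 | TInitial => 5 | TAtLeastOne => 6 | TZero => 7
        | TNot => 8 | TAnd => 9 | TOr => 10
        end.

Lemma token_ordK : cancel token_ord (fun i => nth TOne tokens i).
Proof. by case; rewrite inordK. Qed.

HB.instance Definition _ := Finite.copy token (can_type token_ordK).

(* Numbers are written in unary. All of them are at most [#|Q|] or [#|Sigma|],
   so the length of an encoding is polynomially related to the size of the
   process (which counts [Q], [Sigma], [R], [Q0]) plus that of the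
   constraint. *)
Definition encode_nat (k : nat) : seq token := rcons (nseq k TOne) TEnd.

Definition encode_rule (n m : nat) (r : rule 'I_n 'I_m) : seq token :=
  match r with
  | (q, Broadcast a, q') =>
      TBroadcast :: encode_nat q ++ encode_nat a ++ encode_nat q'
  | (q, Receive a, q') =>
      TReceive :: encode_nat q ++ encode_nat a ++ encode_nat q'
  | (q, Internal, q') => TInternal :: encode_nat q ++ encode_nat q'
  end.

Definition encode_initial (n : nat) (q : 'I_n) : seq token :=
  TInitial :: encode_nat q.

(* Prefix notation. *)
Fixpoint encode_constraint (n : nat) (phi : constraint 'I_n) : seq token :=
  match phi with
  | AtLeastOne q => TAtLeastOne :: encode_nat q
  | Zero q => TZero :: encode_nat q
  | Not psi => TNot :: encode_constraint psi
  | And psi1 psi2 => TAnd :: encode_constraint psi1 ++ encode_constraint psi2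
  | Or psi1 psi2 => TOr :: encode_constraint psi1 ++ encode_constraint psi2
  end.

Definition encode_instance (I : instance) : seq token :=
  encode_nat (nstates I) ++ encode_nat (nmessages I) ++
  flatten (map (@encode_rule _ _) (rule_list I)) ++
  flatten (map (@encode_initial _) (initial_list I)) ++
  encode_constraint (inst_constraint I).

Lemma encode_nat_inj k1 k2 s1 s2 :
  encode_nat k1 ++ s1 = encode_nat k2 ++ s2 -> k1 = k2 /\ s1 = s2.
Proof.
by elim: k1 k2 => [|k1 IH] [|k2] //= [] // /IH [-> ->].
Qed.

Lemma encode_constraint_inj n (phi1 phi2 : constraint 'I_n) s1 s2 :
  encode_constraint phi1 ++ s1 = encode_constraint phi2 ++ s2 ->
  phi1 = phi2 /\ s1 = s2.
Proof.
elim: phi1 phi2 s1 s2 => [q|q|p IH|p IHp r IHr|p IHp r IHr];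
  case=> [q'|q'|p'|p' r'|p' r'] s1 s2 //= [].
- by case/encode_nat_inj => /val_inj -> ->.
- by case/encode_nat_inj => /val_inj -> ->.
- by case/IH => -> ->.
- by rewrite -!catA => /IHp [-> /IHr [-> ->]].
- by rewrite -!catA => /IHp [-> /IHr [-> ->]].
Qed.

Lemma encode_rule_inj n m (r1 r2 : rule 'I_n 'I_m) s1 s2 :
  encode_rule r1 ++ s1 = encode_rule r2 ++ s2 -> r1 = r2 /\ s1 = s2.
Proof.
case: r1 r2 => [[q1 [a1|a1|]] q1'] [[q2 [a2|a2|]] q2'] //= [];
  rewrite -?catA => /encode_nat_inj [/val_inj ->] /encode_nat_inj [/val_inj ->];
  by [move=> ->|case/encode_nat_inj => /val_inj -> ->].
Qed.

Lemma encode_instance_inj : injective encode_instance.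
Proof.
case=> [n1 m1 rs1 qs1 f1] [n2 m2 rs2 qs2 f2]; rewrite /encode_instance /=.
case/encode_nat_inj => en; case/encode_nat_inj => em.
move: rs1 qs1 f1; rewrite {}en {}em {n1 m1} => rs1 qs1 f1 E.
suff: [/\ rs1 = rs2, qs1 = qs2 & f1 = f2] by case=> -> -> ->.
have Eq : flatten (map (@encode_initial n2) qs1) ++ encode_constraint f1 =
          flatten (map (@encode_initial n2) qs2) ++ encode_constraint f2 ->
          qs1 = qs2 /\ f1 = f2.
  elim: qs1 (qs2) {E} => [|q qs IH] [|q' qs'] //=.
  - by move=> E; split=> //; have [] := @encode_constraint_inj _ f1 f2 [::] [::];
      rewrite ?cats0.
  - by case: (f1).
  - by case: (f2).
  - by case; rewrite -!catA => /encode_nat_inj [/val_inj -> /IH [-> ->]].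
suff [-> /Eq [-> ->]//] : rs1 = rs2 /\
  flatten (map (@encode_initial n2) qs1) ++ encode_constraint f1 =
  flatten (map (@encode_initial n2) qs2) ++ encode_constraint f2.
elim: rs1 (rs2) {Eq} E => [|r rs IH] [|r' rs'] //=.
- by case: r' => [[? [?|?|]] ?]; case: (qs1) => //=; case: (f1).
- by case: r => [[? [?|?|]] ?]; case: (qs2) => //=; case: (f2).
- by rewrite -!catA => /encode_rule_inj [-> /IH [-> ->]].
Qed.

(** * Deterministic multi-tape Turing machines *)

Inductive direction : Type := MoveLeft | Stay | MoveRight.

(* A cell contains a letter of [G] or is blank ([None]). The tape with contents
   [... None None rev l r None None ...] and head on the first cell of [r] is
   [(l, r)]: [l] lists the cells to the left of the head, nearest first, and
   everything beyond the two lists is blank. *)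
Definition tape (G : Type) : Type := (seq (option G) * seq (option G))%type.

Definition tape_read (G : Type) (t : tape G) : option G := head None t.2.

Definition tape_write (G : Type) (t : tape G) (s : option G) : tape G :=
  (t.1, s :: behead t.2).

Definition tape_move (G : Type) (t : tape G) (d : direction) : tape G :=
  match d with
  | MoveLeft => (behead t.1, head None t.1 :: t.2)
  | Stay => t
  | MoveRight => (head None t.2 :: t.1, behead t.2)
  end.

Definition blank_tape (G : Type) : tape G := ([::], [::]).

Definition word_tape (G : Type) (w : seq G) : tape G := ([::], map Some w).

(* The tape contains [w], surrounded by blanks, with the head on its first
   letter. *)
Definition tape_contains (G : Type) (t : tape G) (w : seq G) : Prop :=
  exists i j, t = (nseq i None, map Some w ++ nseq j None).

(* The machine halts when [tm_delta] returns [None]. *)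
Record machine (k : nat) (G : finType) : Type := Machine {
  tm_state : finType;
  tm_start : tm_state;
  tm_accept : {set tm_state};
  tm_delta : tm_state -> {ffun 'I_k -> option G} ->
             option (tm_state * {ffun 'I_k -> option G * direction})
}.

Definition tm_config (k : nat) (G : finType) (M : machine k G) : Type :=
  (tm_state M * ('I_k -> tape G))%type.

Definition tm_action (k : nat) (G : finType) (M : machine k G)
    (c : tm_config M) :=
  tm_delta c.1 [ffun i => tape_read (c.2 i)].

Definition tm_halted (k : nat) (G : finType) (M : machine k G)
    (c : tm_config M) : bool := ~~ isSome (tm_action c).

Definition tm_step (k : nat) (G : finType) (M : machine k G)
    (c : tm_config M) : tm_config M :=
  match tm_action c with
  | None => c
  | Some (q, act) =>
      (q, fun i => tape_move (tape_write (c.2 i) (act i).1) (act i).2)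
  end.

(* The initial configuration with [x] on tape 0, [y] on tape 1, and all other
   tapes blank. *)
Definition tm_init (k : nat) (G : finType) (M : machine k.+2 G)
    (x y : seq G) : tm_config M :=
  (tm_start M, fun i : 'I_k.+2 => match val i with
                                  | 0 => word_tape x
                                  | 1 => word_tape y
                                  | _ => blank_tape G
                                  end).

(** * NP-completeness *)

Definition language (A : finType) : Type := seq A -> Prop.

Definition polytime_decidable (A C : finType) (V : seq A -> seq C -> Prop) :
    Prop :=
  exists (k : nat) (G : finType) (iA : A -> G) (iC : C -> G)
         (M : machine k.+2 G) (p : {poly nat}),
    [/\ injective iA, injective iC &
        forall x y,
          let c := iter p.[(size x + size y)%N]%R (@tm_step _ _ M)
                        (tm_init M (map iA x) (map iC y)) in
          tm_halted c /\ (V x y <-> c.1 \in tm_accept M)].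

(* The input is on tape 0 and the output on tape 1. *)
Definition polytime_computable (A B : finType) (f : seq A -> seq B) : Prop :=
  exists (k : nat) (G : finType) (iA : A -> G) (iB : B -> G)
         (M : machine k.+2 G) (p : {poly nat}),
    [/\ injective iA, injective iB &
        forall x,
          let c := iter p.[size x]%R (@tm_step _ _ M)
                        (tm_init M (map iA x) [::]) in
          tm_halted c /\
          tape_contains (c.2 (inord 1)) (map iB (f x))].

Definition in_NP (A : finType) (L : language A) : Prop :=
  exists (C : finType) (V : seq A -> seq C -> Prop) (p : {poly nat}),
    polytime_decidable V /\
    forall x, L x <-> exists2 y : seq C, size y <= p.[size x]%R & V x y.

Definition poly_reducible (A B : finType) (L : language A) (L' : language B) :
    Prop :=
  exists f : seq A -> seq B,
    polytime_computable f /\ forall x, L x <-> L' (f x).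

Definition NP_hard (B : finType) (L : language B) : Prop :=
  forall (A : finType) (L' : language A), in_NP L' -> poly_reducible L' L.

Definition NP_complete (B : finType) (L : language B) : Prop :=
  in_NP L /\ NP_hard L.

(* The set of encodings of the instances having property [Pb]. *)
Definition encoded (T : Type) (B : finType) (enc : T -> seq B)
    (Pb : T -> Prop) : language B :=
  fun w => exists2 I : T, w = enc I & Pb I.

Definition PRP (I : instance) : Prop :=
  reaches (inst_process I) (inst_constraint I).

(* Main.v *)
Require Import Defs.
From Stdlib Require Import FunctionalExtensionality Relation_Operators.
From HB Require Import structures.
From mathcomp Require Import all_boot all_order all_algebra.
From mathcomp Require Import zify.

Set Implicit Arguments.
Unset Strict Implicit.
Unset Printing Implicit Defensive.

(** Membership. Networks can run side by side without interacting, so only the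
    set of states occurring in a configuration matters. If a configuration
    satisfying the constraint is reachable, list the states of the run in the
    order of their first occurrence, and those missing at the end in the order
    of their last occurrence: each state of the first list is obtained from
    earlier ones by one rule, and each state of the second list can be emptied
    into states that survive it by one rule. Conversely, such lists yield a
    run that first produces all the states and then eliminates the superfluous
    ones. They have polynomial size and are checked by simple scans.

    Hardness. With no rules and with all states initial, the labels of a
    configuration form an arbitrary set, so reachability is satisfiability of
    the constraint. A computation of a multi-tape machine is described by a
    tableau whose rows store the tapes relative to their heads; each cell then
    depends on three cells of the previous row and on its first cell.

    Machines. Polynomial time is obtained from a class of functions on words
    closed under composition, case analysis, and bounded recursion; its members
    are computed by programs on stacks, and a stack is a tape whose head is on
    the first letter of a word. *)

(** * Stack programs *)

(** Neither the size of the network nor the length of the run is bounded in advance, so a run itself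
    is no certificate. What helps is that a reachable set of labels can be realized in several
    disjoint copies: copies supply a sender distinct from each receiver, and preserve states that a
    step would consume. The obstacle is elimination, which is not monotone: a broadcast that
    triggers the last reception out of a state must start and end in states that survive. Looking at
    last occurrences settles this. After the last configuration with an unlisted state, all labels
    are listed; if the sender of that step comes from an unlisted state, its own rule eliminates
    that state, and otherwise its broadcast stays among listed states. For hardness, storing tapes
    relative to the heads removes head positions from the formula, at the price that every cell
    consults the first one to learn the moves. The reduction has to be computed by a machine, so the
    formula is made of templates of fixed shape in which only unary cell numbers vary with the
    input. *)

Section StackPrograms.
Variable G : finType.

Definition store : Type := nat -> seq G.

Definition upd (s : store) (r : nat) (w : seq G) : store :=
  fun i => if i == r then w else s i.

Inductive stack_op : Type := Keep | Put of G | Drop.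

Definition apply_op (o : stack_op) (w : seq G) : seq G :=
  match o with Keep => w | Put a => a :: w | Drop => behead w end.

(* In each state a program inspects the top of one stack, acts on that stack,
   and moves to another state or exits ([None]). *)
Record prog : Type := Prog {
  pstate : finType;
  pstart : pstate;
  preg : pstate -> nat;
  pact : pstate -> option G -> stack_op * option pstate
}.

Inductive runs (p : prog) : pstate p -> store -> nat -> store -> Prop :=
  | RunsExit q s o of pact q (ohead (s (preg q))) = (o, None) :
      runs q s 1 (upd s (preg q) (apply_op o (s (preg q))))
  | RunsStep q s o q' t s' of pact q (ohead (s (preg q))) = (o, Some q') &
      runs q' (upd s (preg q) (apply_op o (s (preg q)))) t s' :
      runs q s t.+1 s'.

Definition execB (p : prog) (s : store) (B : nat) (s' : store) : Prop :=
  exists2 t, t <= B & runs (pstart p) s t s'.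

Lemma runs_size p (q : pstate p) s t s' r :
  runs q s t s' -> size (s' r) <= size (s r) + t.
Proof.
have H w o : size (apply_op o w) <= (size w).+1.
  by case: o => [|a|] //=; rewrite size_behead; lia.
elim=> [{}q {}s o _|{}q {}s o q' {}t {}s' _ _ IH].
  by rewrite /upd; case: eqP => [->|_]; rewrite ?leq_addr // addn1.
apply: leq_trans IH _; rewrite /upd; case: eqP => [->|_]; last by lia.
by move: (H (s (preg q)) o); lia.
Qed.

Lemma execB_le p s B B' s' : B <= B' -> execB p s B s' -> execB p s B' s'.
Proof. by move=> le [t tB R]; exists t => //; apply: leq_trans le. Qed.

Definition op_prog (r : nat) (o : stack_op) : prog :=
  @Prog unit tt (fun _ => r) (fun _ _ => (o, None)).

Lemma execB_op r o s : execB (op_prog r o) s 1 (upd s r (apply_op o (s r))).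
Proof. by exists 1 => //; apply: (@RunsExit (op_prog r o) tt). Qed.

Definition pseq (p1 p2 : prog) : prog :=
  @Prog (pstate p1 + pstate p2)%type (inl (pstart p1))
    (fun q => match q with inl q1 => preg q1 | inr q2 => preg q2 end)
    (fun q a => match q with
       | inl q1 => let: (o, n) := pact q1 a in
           (o, Some (if n is Some q' then inl q' else inr (pstart p2)))
       | inr q2 => let: (o, n) := pact q2 a in (o, omap inr n)
       end).

Lemma execB_seq p1 p2 s s1 s2 B1 B2 :
  execB p1 s B1 s1 -> execB p2 s1 B2 s2 -> execB (pseq p1 p2) s (B1 + B2) s2.
Proof.
move=> [t1 t1B R1] [t2 t2B R2]; exists (t1 + t2); first by rewrite leq_add.
have {}R2 : @runs (pseq p1 p2) (inr (pstart p2)) s1 t2 s2.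
  elim: R2 => [q u o H|q u o q' t s' H _ IH].
    by apply: (@RunsExit (pseq p1 p2) (inr q)); rewrite /= H.
  by apply: (@RunsStep (pseq p1 p2) (inr q) _ _ (inr q') _ _ _ IH); rewrite /= H.
rewrite /=; elim: R1 R2 {t1B t2B} => [q u o H|q u o q' t s' H _ IH] R2.
  by apply: (@RunsStep (pseq p1 p2) (inl q) _ _ _ _ _ _ R2); rewrite /= H.
rewrite addSn.
by apply: (@RunsStep (pseq p1 p2) (inl q) _ _ (inl q') _ _ _ (IH R2)); rewrite /= H.
Qed.

Definition pcase (r : nat) (body : option G -> prog) : prog :=
  @Prog (option {o : option G & pstate (body o)}) None
    (fun q => if q is Some u then preg (tagged u) else r)
    (fun q a => match q with
       | None => (Keep, Some (Some (Tagged (fun o => pstate (body o)) (pstart (body a)))))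
       | Some u => let: (o, n) := pact (tagged u) a in
           (o, omap (fun q' => Some (Tagged (fun o => pstate (body o)) q')) n)
       end).

Lemma upd_id s r : upd s r (s r) = s.
Proof. by apply: functional_extensionality => i; rewrite /upd; case: eqP => [->|]. Qed.

Lemma execB_case r body s B s' :
  execB (body (ohead (s r))) s B s' -> execB (pcase r body) s B.+1 s'.
Proof.
move=> [t tB R]; exists t.+1 => //.
apply: (@RunsStep (pcase r body) None s Keep); first by [].
rewrite /= upd_id; move: R; move: (ohead _) (pstart _) => o q R.
elim: R {tB} => [{}q u o' H|{}q u o' q' {}t u' H _ IH].
  by apply: (@RunsExit (pcase r body) (Some (Tagged (fun o => pstate (body o)) q)) u o');
    rewrite /= H.
by apply: (@RunsStep (pcase r body) (Some (Tagged (fun o => pstate (body o)) q)) u o' _ _ _ _ IH);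
  rewrite /= H.
Qed.

(** The popped letter selects the body. If each body leaves [r] as it finds it, the number of rounds
    is the initial height of the stack, which makes termination and time bounds immediate. *)
Definition ploop (r : nat) (body : G -> prog) : prog :=
  @Prog (option {a : G & pstate (body a)}) None
    (fun q => if q is Some u then preg (tagged u) else r)
    (fun q top => match q, top with
       | None, None => (Keep, None)
       | None, Some a => (Drop, Some (Some (Tagged (fun a => pstate (body a)) (pstart (body a)))))
       | Some u, _ => let: (o, n) := pact (tagged u) top in
           (o, Some (omap (fun q' => Tagged (fun a => pstate (body a)) q') n))
       end).

(* [S w] is the store when [w] remains to be processed. *)
Lemma execB_loop r body (S : seq G -> store) B w0 :
  (forall w, S w r = w) ->
  (forall w1 a w, w0 = w1 ++ a :: w -> execB (body a) (upd (S (a :: w)) r w) B (S w)) ->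
  execB (ploop r body) (S w0) ((B + 1) * size w0 + 1) (S [::]).
Proof.
move=> Sr; elim: w0 => [|a w IH] Sb.
  exists 1; first by lia.
  have := @RunsExit (ploop r body) None (S [::]) Keep.
  by rewrite /= upd_id Sr; apply.
have [t2 t2B R2] : execB (ploop r body) (S w) ((B + 1) * size w + 1) (S [::]).
  by apply: IH => w1 a' w' E; apply: (Sb (a :: w1)); rewrite E.
have [t1 t1B R1] := Sb [::] a w erefl.
exists (t1 + t2).+1; first by rewrite /=; lia.
apply: (@RunsStep (ploop r body) None _ Drop); first by rewrite /= Sr.
rewrite /= Sr /=; move: R1; move: (pstart (body a)) => q R1.
elim: R1 R2 {IH Sb t1B} => [{}q u o' H|{}q u o' q' {}t1 u' H _ IH] R2.
  by apply: (@RunsStep (ploop r body) (Some (Tagged (fun a => pstate (body a)) q)) u o' _ _ _ _ R2); rewrite /= H.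
rewrite addSn.
by apply: (@RunsStep (ploop r body) (Some (Tagged (fun a => pstate (body a)) q)) u o' _ _ _ _ (IH R2)); rewrite /= H.
Qed.

Definition pclear (r : nat) : prog := ploop r (fun _ => op_prog r Keep).

Lemma execB_clear r s : execB (pclear r) s (2 * size (s r) + 1) (upd s r [::]).
Proof.
rewrite -{1}(upd_id s r).
apply: (@execB_loop r _ (upd s r) 1) => [w|w1 a w _]; first by rewrite /upd eqxx.
have -> : upd s r w = upd (upd (upd s r (a :: w)) r w) r (apply_op Keep (upd (upd s r (a :: w)) r w r)).
  by apply: functional_extensionality => i; rewrite /upd eqxx; case: eqP.
exact: execB_op.
Qed.

Definition pflip (r r' : nat) : prog := ploop r (fun a => op_prog r' (Put a)).

Lemma execB_flip r r' s : r != r' ->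
  execB (pflip r r') s (2 * size (s r) + 1)
    (upd (upd s r [::]) r' (catrev (s r) (s r'))).
Proof.
move=> ne; pose S w := upd (upd s r w) r' (catrev (take (size (s r) - size w) (s r)) (s r')).
have -> : upd (upd s r [::]) r' (catrev (s r) (s r')) = S [::].
  by rewrite /S subn0 take_size.
have {1}-> : s = S (s r) by rewrite /S subnn take0 /= !upd_id -{1}(upd_id s r') upd_id.
apply: (@execB_loop r _ S 1) => [w|w1 a w E].
  by rewrite /S /upd (negbTE ne) eqxx.
suff -> : S w = upd (upd (S (a :: w)) r w) r' (apply_op (Put a) (upd (S (a :: w)) r w r')).
  exact: execB_op.
apply: functional_extensionality => i; rewrite /S /upd !eqxx (eq_sym r') (negbTE ne) /= E size_cat /=.
have [_|_] := eqVneq i r'; last by case: eqP.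
have -> : size w1 + (size w).+1 - size w = (size w1).+1 by lia.
have -> : size w1 + (size w).+1 - (size w).+1 = size w1 by lia.
have -> : take (size w1).+1 (w1 ++ a :: w) = rcons w1 a.
  by rewrite -cat_rcons take_size_cat ?size_rcons.
by rewrite take_size_cat // !catrevE rev_rcons.
Qed.

(** One flip reverses the word; the second, through the scratch stack [t], restores its order. *)
Definition ptransfer (r t r' : nat) : prog :=
  pseq (pclear r') (pseq (pflip r t) (pflip t r')).

Lemma execB_transfer r t r' s : r != t -> t != r' -> r != r' -> s t = [::] ->
  execB (ptransfer r t r') s (2 * size (s r') + 4 * size (s r) + 3)
    (upd (upd s r [::]) r' (s r)).
Proof.
move=> n1 n2 n3 st.
move: (negbTE n1) (negbTE n2) (negbTE n3) => m1 m2 m3.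
have E1 := execB_clear r' s; set s1 := upd _ _ _ in E1.
have s1r : s1 r = s r by rewrite /s1 /upd m3.
have s1t : s1 t = [::] by rewrite /s1 /upd m2.
have E2 := execB_flip s1 n1; rewrite s1r s1t catrevE cats0 in E2.
set s2 := upd (upd _ _ _) _ _ in E2.
have s2t : s2 t = rev (s r) by rewrite /s2 /upd eqxx.
have s2r' : s2 r' = [::] by rewrite /s2 /s1 /upd eqxx eq_sym m2; case: eqP.
have E3 := execB_flip s2 n2; rewrite s2t s2r' size_rev catrevE revK cats0 in E3.
have -> : upd (upd s r [::]) r' (s r) = upd (upd s2 t [::]) r' (s r).
  apply: functional_extensionality => i; rewrite /s2 /s1 /upd.
  have [//|_] := eqVneq i r'; have [->|_] := eqVneq i t; last by [].
  by rewrite eq_sym m1.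
by apply: execB_le (execB_seq E1 (execB_seq E2 E3)); lia.
Qed.

End StackPrograms.

Arguments Keep {G}.
Arguments Drop {G}.
Arguments pclear {G}.
Arguments pflip {G}.
Arguments ptransfer {G}.

(** * Functions computable in polynomial time *)

Ltac store_eq :=
  apply: functional_extensionality => ?; rewrite /upd;
  repeat (case: eqP => ?); subst; try done; try congruence; try lia.

(** Environments are indexed as with de Bruijn indices: a newly bound argument gets index 0. *)
Definition scons (T : Type) (x : T) (e : nat -> T) : nat -> T :=
  fun i => if i is j.+1 then e j else x.

(** The step also receives the remaining suffix, because the numbers that follow a tag have to be
    read from it. *)
Fixpoint para (G T : Type) (f : G -> seq G -> T -> T) (x0 : T) (l : seq G) : T :=
  if l is a :: w then f a w (para f x0 w) else x0.

(** * Polynomial bounds in the total size of the arguments *)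

Section PolynomialBounds.
Variable G : Type.
Implicit Types (e : nat -> seq G) (c u : (nat -> seq G) -> nat).

Definition esize (n : nat) e : nat := \sum_(i < n) size (e i).

(** A bound of this shape has the single parameter [d]; as its base is at least 2, constants and
    sums are absorbed by increasing [d]. *)
Definition PB (n : nat) c : Prop := exists d, forall e, c e <= (esize n e + 2) ^ d.

Lemma esize_scons n w e : esize n.+1 (scons w e) = size w + esize n e.
Proof. by rewrite /esize big_ord_recl. Qed.

Lemma PB_le n c c' : (forall e, c e <= c' e) -> PB n c' -> PB n c.
Proof. by move=> le [d H]; exists d => e; apply: leq_trans (le e) (H e). Qed.

Lemma PB_const n k : PB n (fun _ => k).
Proof.
exists k => e; apply: leq_trans (ltnW (ltn_expl k (isT : 1 < 2))) _.
by case: k => // k; rewrite leq_exp2r // leq_addl.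
Qed.

Lemma PB_mul n c c' : PB n c -> PB n c' -> PB n (fun e => c e * c' e).
Proof. by move=> [d H] [d' H']; exists (d + d') => e; rewrite expnD leq_mul. Qed.

Lemma PB_add n c c' : PB n c -> PB n c' -> PB n (fun e => c e + c' e).
Proof.
move=> [d H] [d' H']; exists (d + d').+1 => e.
move: (H e) (H' e); set x := _ + 2 => h h'.
have x2 : 1 < x by rewrite /x addn2.
have l1 : x ^ d <= x ^ (d + d') by rewrite leq_exp2l ?leq_addr.
have l2 : x ^ d' <= x ^ (d + d') by rewrite leq_exp2l ?leq_addl.
rewrite expnS; apply: leq_trans (_ : 2 * x ^ (d + d') <= _); first by lia.
by rewrite leq_mul2r x2 orbT.
Qed.

Lemma PB_exp n c k : PB n c -> PB n (fun e => c e ^ k).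
Proof.
move=> Hc; elim: k => [|k IH]; first exact: PB_const.
by apply: PB_le (PB_mul Hc IH) => e; rewrite expnS.
Qed.

Lemma PB_esize n : PB n (esize n).
Proof. by exists 1 => e; rewrite expn1 leq_addr. Qed.

Lemma PB_subst m n c u (h : (nat -> seq G) -> nat -> seq G) :
  PB m c -> PB n u -> (forall e, esize m (h e) <= u e) -> PB n (fun e => c (h e)).
Proof.
move=> [d Hc] Hu le; apply: PB_le (PB_exp d (PB_add Hu (PB_const n 2))) => e.
apply: leq_trans (Hc _) _; case: d {Hc} => // d.
by rewrite leq_exp2r // leq_add2r.
Qed.

Lemma esize_ren m n (sg : nat -> nat) e : (forall i, i < m -> sg i < n) ->
  esize m (fun i => e (sg i)) <= m * esize n e.
Proof.
move=> H; apply: leq_trans (_ : \sum_(i < m) esize n e <= _).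
  apply: leq_sum => i _; rewrite /esize (bigD1 (Ordinal (H _ (ltn_ord i)))) //=.
  exact: leq_addr.
by rewrite sum_nat_const card_ord.
Qed.

End PolynomialBounds.

Arguments PB_const {G}.
Arguments PB_esize {G}.

Ltac pb := first [ assumption | exact: PB_const | exact: PB_esize
  | apply: PB_mul; pb | apply: PB_add; pb | apply: PB_exp; pb ].

(** * Closure properties of the polynomial-time functions *)

Section PolynomialTimeFunctions.
Variable G : finType.
Implicit Types (e : nat -> seq G) (f : (nat -> seq G) -> seq G) (s : store G).

(* [f] is a function of the first [n] arguments. The program finds its
   arguments on the stacks [rho 0], ..., [rho n.-1], leaves them unchanged,
   uses only the (initially empty) stacks from [b] on, and returns the result
   on stack [b]. *)
Definition PT (n : nat) f : Prop :=
  (forall e e', (forall i, i < n -> e i = e' i) -> f e = f e') /\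
  exists (c : (nat -> nat) -> nat -> prog G) (d : nat),
    forall (rho : nat -> nat) b s,
      (forall i, i < n -> rho i < b) -> (forall j, b <= j -> s j = [::]) ->
      execB (c rho b) s ((esize n (fun i => s (rho i)) + 2) ^ d)
        (upd s b (f (fun i => s (rho i)))).

Lemma PT_intro n f (c : (nat -> nat) -> nat -> prog G) (tau : (nat -> seq G) -> nat) :
  (forall e e', (forall i, i < n -> e i = e' i) -> f e = f e') ->
  PB n tau ->
  (forall (rho : nat -> nat) b s,
      (forall i, i < n -> rho i < b) -> (forall j, b <= j -> s j = [::]) ->
      execB (c rho b) s (tau (fun i => s (rho i))) (upd s b (f (fun i => s (rho i))))) ->
  PT n f.
Proof.
move=> ext [d Hd] H; split=> //; exists c, d => rho b s H1 H2.
by apply: execB_le (H _ _ _ H1 H2).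
Qed.

Lemma PT_eq n f f' : (forall e, f e = f' e) -> PT n f -> PT n f'.
Proof. by move=> /functional_extensionality ->. Qed.

(** A step pushes at most one letter and the result stack starts empty, so the time bound also
    bounds the output. The program is run with argument [i] on stack [i]. *)
Lemma PT_size n f : PT n f -> PB n (fun e => size (f e)).
Proof.
move=> [ext [c [d H]]]; exists d => e.
pose s : store G := fun i => if i < n then e i else [::].
have [||t tB /runs_size] := H id n s => // [j|].
  by rewrite /s ltnNge => ->.
move=> /(_ n); rewrite {1}/upd eqxx (ext _ e) => [le|i]; last by rewrite /s => ->.
apply: leq_trans le _; rewrite {1}/s ltnn; apply: leq_trans tB _.
suff -> : esize n (fun i => s i) = esize n e by [].
by apply: eq_bigr => i _; rewrite /s ltn_ord.
Qed.

(** Reading a stack destroys it: the word is flipped onto [t], and each letter is then pushed back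
    on [r] and on [r'] together. *)
Lemma execB_copy r t r' s : r != t -> t != r' -> r != r' -> s t = [::] -> s r' = [::] ->
  execB (pseq (pflip r t) (ploop t (fun a => pseq (op_prog r (Put a)) (op_prog r' (Put a)))))
    s (5 * size (s r) + 2) (upd s r' (s r)).
Proof.
move=> n1 n2 n3 st sr'; have E1 := execB_flip s n1.
rewrite st catrevE cats0 in E1.
pose S w := upd (upd (upd s t w) r (drop (size w) (s r))) r' (drop (size w) (s r)).
have E2 : execB (ploop t (fun a => pseq (op_prog r (Put a)) (op_prog r' (Put a))))
    (S (rev (s r))) ((2 + 1) * size (rev (s r)) + 1) (S [::]).
  apply: execB_loop => [w|w1 a w E].
    by rewrite /S /upd (negbTE n2) eq_sym (negbTE n1) eqxx.
  have Er : s r = rev w ++ a :: rev w1.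
    by rewrite -(revK (s r)) E rev_cat rev_cons cat_rcons.
  have D1 : drop (size w) (s r) = a :: rev w1.
    by rewrite Er -(size_rev w) drop_size_cat.
  have D2 : drop (size w).+1 (s r) = rev w1.
    by rewrite -addn1 addnC -drop_drop D1 /= drop0.
  set s0 := upd _ _ _.
  have F1 := execB_op r (Put a) s0; have F2 := execB_op r' (Put a) (upd s0 r (a :: s0 r)).
  suff -> : S w = upd (upd s0 r (a :: s0 r)) r' (a :: (upd s0 r (a :: s0 r)) r').
    exact: execB_seq F1 F2.
  rewrite /s0 /S /= D1 D2 {F1 F2}; move: n1 n2 n3 => /eqP n1 /eqP n2 /eqP n3; store_eq.
have -> : upd s r' (s r) = S [::].
  by rewrite /S drop0; move: n1 n2 n3 => /eqP n1 /eqP n2 /eqP n3; store_eq.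
apply: execB_le (execB_seq E1 _); last first.
  suff -> : upd (upd s r [::]) t (rev (s r)) = S (rev (s r)) by exact: E2.
  rewrite /S size_rev drop_size; move: n1 n2 n3 => /eqP n1 /eqP n2 /eqP n3; store_eq.
by rewrite size_rev; lia.
Qed.

Lemma PT_var n i : i < n -> PT n (fun e => e i).
Proof.
move=> lt; apply: (@PT_intro _ _ (fun rho b => pseq (pflip (rho i) b.+1) (ploop b.+1
  (fun a => pseq (op_prog (rho i) (Put a)) (op_prog b (Put a)))))
  (fun e => 5 * size (e i) + 2)) => [e e' -> //||rho b s /(_ i lt) ltb H].
  apply: PB_le (PB_add (PB_mul (PB_const n 5) (PB_esize n)) (PB_const n 2)) => e.
  by rewrite leq_add2r leq_mul2l /esize (bigD1 (Ordinal lt)) //= leq_addr.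
by apply: execB_copy; rewrite ?H //; lia.
Qed.

Lemma PT_nil n : PT n (fun _ => [::]).
Proof.
apply: (@PT_intro _ _ (fun _ b => op_prog b Keep) (fun _ => 1)) => // [|rho b s _ H].
  exact: PB_const.
by have := execB_op b Keep s; rewrite /= H.
Qed.

Lemma PT_op n f o : PT n f -> PT n (fun e => apply_op o (f e)).
Proof.
move=> [ext [c [d H]]].
apply: (@PT_intro _ _ (fun rho b => pseq (c rho b) (op_prog b o))
  (fun e => (esize n e + 2) ^ d + 1)) => [e e' /ext -> //||rho b s H1 H2].
  by apply: PB_add; [exists d|exact: PB_const].
have E1 := H _ _ _ H1 H2; have := execB_seq E1 (execB_op b o _).
set s1 := upd (upd _ _ _) _ _; set s2 := upd _ _ _; suff -> : s1 = s2 by [].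
by rewrite /s1 /s2; store_eq.
Qed.

Lemma PT_cons n f a : PT n f -> PT n (fun e => a :: f e).
Proof. exact: (@PT_op n f (Put a)). Qed.

Lemma PT_behead n f : PT n f -> PT n (fun e => behead (f e)).
Proof. exact: (@PT_op n f Drop). Qed.

Lemma PT_ren m n f (sg : nat -> nat) : (forall i, i < m -> sg i < n) ->
  PT m f -> PT n (fun e => f (fun i => e (sg i))).
Proof.
move=> Hs [ext [c [d H]]].
apply: (@PT_intro _ _ (fun rho b => c (fun i => rho (sg i)) b)
  (fun e => (esize m (fun i => e (sg i)) + 2) ^ d)) => [e e' E||rho b s H1 H2].
- by apply: ext => i /Hs; apply: E.
- apply: PB_exp; apply: PB_add (PB_const _ _).
  by apply: PB_le (PB_mul (PB_const n m) (PB_esize n)) => e; apply: esize_ren.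
- by apply: (H (fun i => rho (sg i))) => // i /Hs; apply: H1.
Qed.

Lemma execB_call n f c d rho b s v :
  (forall (rho : nat -> nat) b s,
      (forall i, i < n.+1 -> rho i < b) -> (forall j, b <= j -> s j = [::]) ->
      execB (c rho b) s ((esize n.+1 (fun i => s (rho i)) + 2) ^ d)
        (upd s b (f (fun i => s (rho i))))) ->
  (forall e e', (forall i, i < n.+1 -> e i = e' i) -> f e = f e') ->
  (forall i, i < n -> rho i < b) -> (forall j, b < j -> s j = [::]) -> s b = v ->
  execB (pseq (c (scons b rho) b.+1) (ptransfer b.+1 b.+2 b)) s
    ((esize n.+1 (scons v (fun i => s (rho i))) + 2) ^ d +
     (2 * size v + 4 * size (f (scons v (fun i => s (rho i)))) + 3))
    (upd s b (f (scons v (fun i => s (rho i))))).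
Proof.
move=> H ext H1 H2 Hv.
have Eenv i : i < n.+1 -> s (scons b rho i) = scons v (fun i => s (rho i)) i.
  by case: i.
have E1 : execB (c (scons b rho) b.+1) s ((esize n.+1 (scons v (fun i => s (rho i))) + 2) ^ d)
   (upd s b.+1 (f (scons v (fun i => s (rho i))))).
  have -> : esize n.+1 (scons v (fun i => s (rho i))) = esize n.+1 (fun i => s (scons b rho i)).
    by apply: eq_bigr => i _; rewrite Eenv.
  rewrite -(ext _ _ Eenv); apply: H => //.
  by case=> [|i] //= /H1; lia.
set w := f _ in E1 *.
have E2 := @execB_transfer _ b.+1 b.+2 b (upd s b.+1 w).
have U1 : upd s b.+1 w b.+1 = w by rewrite /upd eqxx.
have U2 : upd s b.+1 w b.+2 = [::] by rewrite /upd gtn_eqF // H2.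
have U3 : upd s b.+1 w b = v by rewrite /upd ltn_eqF.
rewrite U1 U2 U3 in E2; have n1 : b.+1 != b.+2 by lia.
have n2 : b.+2 != b by lia.
have n3 : b.+1 != b by lia.
have {}E2 := E2 n1 n2 n3 erefl.
apply: execB_le (execB_seq E1 _); last first.
  have -> : upd s b w = upd (upd (upd s b.+1 w) b.+1 [::]) b w.
    apply: functional_extensionality => i; rewrite /upd; case: eqP => // _.
    by case: eqP => // ->; rewrite H2.
  exact: E2.
by lia.
Qed.

Lemma PT_let n f h : PT n f -> PT n.+1 h -> PT n (fun e => h (scons (f e) e)).
Proof.
move=> Pf Ph; have Sf := PT_size Pf; have Sh := PT_size Ph.
case: Pf => [ext [c [d H]]]; case: Ph => [ext' [c' [d' H']]].
have Ple : PB n (fun e => esize n.+1 (scons (f e) e)).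
  by apply: PB_le (PB_add Sf (PB_esize n)) => e; rewrite esize_scons.
apply: (@PT_intro _ _ (fun rho b => pseq (c rho b) (pseq (c' (scons b rho) b.+1) (ptransfer b.+1 b.+2 b)))
  (fun e => (esize n e + 2) ^ d + ((esize n.+1 (scons (f e) e) + 2) ^ d' +
   (2 * size (f e) + 4 * size (h (scons (f e) e)) + 3))))
  => [e e' E||rho b s H1 H2].
- by apply: ext' => -[|i] //=; [rewrite (ext e e')|exact: E].
- have Shf : PB n (fun e => size (h (scons (f e) e))).
    exact: (PB_subst (h := fun e => scons (f e) e) Sh Ple (fun e => leqnn _)).
  by pb.
- have E1 := H _ _ _ H1 H2; set v := f _ in E1 *.
  apply: (execB_seq E1).
  have E2 := @execB_call n h c' d' rho b (upd s b v) v H' ext' H1.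
  have Eenv i : i < n.+1 -> scons v (fun i => upd s b v (rho i)) i = scons v (fun i => s (rho i)) i.
    by case: i => [|i] //= /H1; rewrite /upd; case: ltngtP.
  have Es : esize n.+1 (scons v (fun i => upd s b v (rho i))) = esize n.+1 (scons v (fun i => s (rho i))).
    by apply: eq_bigr => i _; rewrite Eenv.
  rewrite (ext' _ _ Eenv) Es in E2.
  have <- : upd (upd s b v) b (h (scons v (fun i => s (rho i)))) = upd s b (h (scons v (fun i => s (rho i)))).
    by store_eq.
  by apply: E2; rewrite /upd ?eqxx // => j bj; rewrite gtn_eqF // H2 // ltnW.
Qed.

(** A case analysis on a letter needs one exponent for all branches: the maximum of theirs. *)
Lemma PT_finite (I : finType) n (h : I -> (nat -> seq G) -> seq G) :
  (forall o, PT n (h o)) ->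
  exists (c : I -> (nat -> nat) -> nat -> prog G) d,
    forall o (rho : nat -> nat) b s,
      (forall i, i < n -> rho i < b) -> (forall j, b <= j -> s j = [::]) ->
      execB (c o rho b) s ((esize n (fun i => s (rho i)) + 2) ^ d)
        (upd s b (h o (fun i => s (rho i)))).
Proof.
move=> Ph; have /fin_all_exists [c /fin_all_exists [d H]] := fun o => proj2 (Ph o).
exists c, (\max_o d o) => o rho b s H1 H2; apply: execB_le (H o _ _ _ H1 H2).
by rewrite leq_exp2l ?leq_bigmax // addn2.
Qed.

Lemma PT_case_var n (h : option G -> (nat -> seq G) -> seq G) :
  0 < n -> (forall o, PT n (h o)) -> PT n (fun e => h (ohead (e 0)) e).
Proof.
move=> n0 Ph; have [c [d H]] := PT_finite Ph.
apply: (@PT_intro _ _ (fun rho b => pcase (rho 0) (fun o => c o rho b))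
  (fun e => (esize n e + 2) ^ d + 1)) => [e e' E||rho b s H1 H2].
- by rewrite (E 0) // (proj1 (Ph _) e e').
- by pb.
- by rewrite addn1; apply: execB_case; apply: H.
Qed.

Lemma PT_weak n f : PT n f -> PT n.+1 (fun e => f (fun i => e i.+1)).
Proof. exact: (@PT_ren n n.+1 f succn). Qed.

Lemma PT_weak2 n f : PT n f -> PT n.+2 (fun e => f (fun i => e i.+2)).
Proof. exact: (@PT_ren n n.+2 f (fun i => i.+2)). Qed.

Lemma PT_case n f h0 (h : G -> (nat -> seq G) -> seq G) :
  PT n f -> PT n h0 -> (forall a, PT n (h a)) ->
  PT n (fun e => if f e is a :: _ then h a e else h0 e).
Proof.
move=> Pf Ph0 Ph; pose H o := if o is Some a then h a else h0.
have PH : PT n.+1 (fun e => H (ohead (e 0)) (fun i => e i.+1)).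
  apply: (PT_case_var (h := fun o e => H o (fun i => e i.+1))) => // o.
  by apply: PT_weak; case: o => [a|]; [apply: Ph|apply: Ph0].
by apply: PT_eq (PT_let Pf PH) => e /=; case: (f e).
Qed.

(** The recursion starts at the right end, so the word is flipped onto [b.+1]; [b] collects the
    suffix already treated and [b.+2] holds the accumulator. The bound [u] on intermediate values
    makes this a bounded recursion: without it, an accumulator that doubles at each step would grow
    exponentially. *)
Lemma PT_para n L I (St : G -> seq G -> seq G -> (nat -> seq G) -> seq G)
    (u : (nat -> seq G) -> nat) :
  PT n L -> PT n I ->
  (forall a, PT n.+2 (fun e => St a (e 0) (e 1) (fun i => e i.+2))) ->
  PB n u ->
  (forall e l1 l2, L e = l1 ++ l2 ->
     size (para (fun a w acc => St a w acc e) (I e) l2) <= u e) ->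
  PT n (fun e => para (fun a w acc => St a w acc e) (I e) (L e)).
Proof.
move=> PL PI PS PBu Hu.
have SL := PT_size PL; have SI := PT_size PI.
have [cS [dS HS]] := PT_finite PS.
case: PL => [extL [cL [dL HL]]]; case: PI => [extI [cI [dI HI]]].
have extS a w acc e e' : (forall i, i < n -> e i = e' i) -> St a w acc e = St a w acc e'.
  move=> E; apply: (proj1 (PS a) (scons w (scons acc e)) (scons w (scons acc e'))).
  by case=> [|[|i]] //=; apply: E.
pose cB b rho a := pseq (cS a (scons b (scons b.+2 rho)) b.+3)
  (pseq (ptransfer b.+3 b.+4 b.+2) (op_prog b (Put a))).
(* The cost of one round: the step function on suffix, accumulator and environment, the transfer of
   the new accumulator over the old one, and one push that extends the suffix. *)
pose beta e := (size (L e) + (u e + esize n e) + 2) ^ dS + (2 * u e + 4 * u e + 3 + 1).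
apply: (@PT_intro _ _ (fun rho b => pseq (cL rho b) (pseq (pflip b b.+1) (pseq (cI rho b.+2)
  (pseq (ploop b.+1 (cB b rho)) (ptransfer b.+2 b.+3 b)))))
  (fun e => (esize n e + 2) ^ dL + ((2 * size (L e) + 1) + ((esize n e + 2) ^ dI +
     (((beta e + 1) * size (L e) + 1) + (2 * size (L e) + 4 * u e + 3))))))
  => [e e' E||rho b s H1 H2].
- rewrite (extL _ _ E) (extI _ _ E); elim: (L e') => //= a w ->.
  exact: extS.
- by rewrite /beta; pb.
set e := fun i => s (rho i).
pose R l2 := para (fun a w acc => St a w acc e) (I e) l2.
pose S w := upd (upd (upd s b (drop (size w) (L e))) b.+1 w) b.+2 (R (drop (size w) (L e))).
have E1 := HL _ _ _ H1 H2; rewrite -/e in E1; set s1 := upd _ _ _ in E1.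
have b1 : b != b.+1 by lia.
have E2 := execB_flip s1 b1.
have s1b : s1 b = L e by rewrite /s1 /upd eqxx.
have s1b1 : s1 b.+1 = [::] by rewrite /s1 /upd gtn_eqF // H2.
rewrite s1b s1b1 catrevE cats0 in E2; set s2 := upd (upd _ _ _) _ _ in E2.
have s2e i : i < n -> s2 (rho i) = e i.
  move/H1 => lt; rewrite /s2 /s1 /upd; repeat (case: eqP => ?) => //; lia.
have s2e' : esize n (fun i => s2 (rho i)) = esize n e.
  by apply: eq_bigr => i _; rewrite s2e.
have E3 : execB (cI rho b.+2) s2 ((esize n e + 2) ^ dI) (S (rev (L e))).
  have [i /H1 ?|j bj|t tB R3] := HI rho b.+2 s2; first lia.
    rewrite /s2 /s1 /upd; repeat (case: eqP => ?); try lia; last by rewrite H2 //; lia.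
  exists t; first by rewrite -s2e'.
  suff -> : S (rev (L e)) = upd s2 b.+2 (I (fun i => s2 (rho i))) by [].
  rewrite (extI _ e) // /S size_rev drop_size /R /= /s2 /s1.
  by store_eq.
have E4 : execB (ploop b.+1 (cB b rho)) (S (rev (L e))) ((beta e + 1) * size (L e) + 1) (S [::]).
  rewrite -(size_rev (L e)); apply: execB_loop => [w|w1 a w E].
    by rewrite /S /upd; repeat (case: eqP => ?) => //; lia.
  have El : L e = rev w ++ a :: rev w1.
    by rewrite -(revK (L e)) E rev_cat rev_cons cat_rcons.
  have D1 : drop (size w) (L e) = a :: rev w1.
    by rewrite El -(size_rev w) drop_size_cat.
  have D2 : drop (size w).+1 (L e) = rev w1.
    by rewrite -addn1 addnC -drop_drop D1 /= drop0.
  set s3 := upd _ _ _.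
  have s3b : s3 b = rev w1.
    by rewrite /s3 /S /upd /= D2; repeat (case: eqP => ?) => //; lia.
  have s3b2 : s3 b.+2 = R (rev w1).
    by rewrite /s3 /S /upd /= D2; repeat (case: eqP => ?) => //; lia.
  have s3e i : i < n.+2 -> s3 (scons b (scons b.+2 rho) i) = scons (rev w1) (scons (R (rev w1)) e) i.
    case: i => [|[|i]] //= /H1 ltb; rewrite /s3 /S /upd.
    by repeat (case: eqP => ?) => //; lia.
  have s3hi j : b.+3 <= j -> s3 j = [::].
    move=> lt; rewrite /s3 /S /upd; repeat (case: eqP => ?); try lia.
    by rewrite H2 //; lia.
  have F1 : execB (cS a (scons b (scons b.+2 rho)) b.+3) s3
      ((esize n.+2 (scons (rev w1) (scons (R (rev w1)) e)) + 2) ^ dS)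
      (upd s3 b.+3 (R (a :: rev w1))).
    have -> : esize n.+2 (scons (rev w1) (scons (R (rev w1)) e)) =
        esize n.+2 (fun i => s3 (scons b (scons b.+2 rho) i)).
      by apply: eq_bigr => i _; rewrite s3e.
    have -> : R (a :: rev w1) = (fun e0 : nat -> seq G => St a (e0 0) (e0 1) (fun i => e0 i.+2))
        (fun i => s3 (scons b (scons b.+2 rho) i)).
      exact: (esym (proj1 (PS a) _ _ s3e)).
    apply: HS => // i; case: i => [|[|i]] //=; rewrite ?ltnS; try lia.
    by move/H1; lia.
  set s4 := upd _ _ _ in F1.
  have n1 : b.+3 != b.+4 by lia.
  have n2 : b.+4 != b.+2 by lia.
  have n3 : b.+3 != b.+2 by lia.
  have s4b4 : s4 b.+4 = [::] by rewrite /s4 /upd gtn_eqF // s3hi.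
  have F2 := execB_transfer n1 n2 n3 s4b4.
  have s4b3 : s4 b.+3 = R (a :: rev w1) by rewrite /s4 /upd eqxx.
  have s4b2 : s4 b.+2 = R (rev w1) by rewrite /s4 /upd ltn_eqF.
  rewrite s4b3 s4b2 in F2; set s5 := upd (upd _ _ _) _ _ in F2.
  have F3 := execB_op b (Put a) s5.
  have F := execB_seq F1 (execB_seq F2 F3).
  have -> : S w = upd s5 b (apply_op (Put a) (s5 b)).
    have -> : s5 b = rev w1.
      by rewrite /s5 /s4 /upd; repeat (case: eqP => ?); try lia.
    have hi3 : s b.+3 = [::] by rewrite H2 //; lia.
    rewrite /S /s5 /s4 /s3 /S /= D1 D2.
    by apply: functional_extensionality => i; rewrite /upd; repeat (case: eqP => ?); subst; try done; try lia.
  apply: execB_le F; rewrite !esize_scons /beta.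
  have L1 : size (rev w1) <= size (L e) by rewrite El size_cat /=; lia.
  have L2 : size (R (rev w1)) <= u e.
    by apply: (Hu e (rev w ++ [:: a])); rewrite El -catA.
  have L3 : size (R (a :: rev w1)) <= u e by apply: (Hu e (rev w)).
  have : (size (rev w1) + (size (R (rev w1)) + esize n e) + 2) ^ dS <=
     (size (L e) + (u e + esize n e) + 2) ^ dS.
    by case: (dS) => // d0; rewrite leq_exp2r //; lia.
  by lia.
have n1 : b.+2 != b.+3 by lia.
have n2 : b.+3 != b by lia.
have n3 : b.+2 != b by lia.
have h3 : s b.+3 = [::] by rewrite H2 //; lia.
have h2 : s b.+2 = [::] by rewrite H2 //; lia.
have h1 : s b.+1 = [::] by rewrite H2 //; lia.
have Sb3 : S [::] b.+3 = [::] by rewrite /S /upd; repeat (case: eqP => ?); try lia.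
have E5 := execB_transfer n1 n2 n3 Sb3.
have Sb2 : S [::] b.+2 = R (L e) by rewrite /S /upd eqxx drop0.
have Sb : S [::] b = L e by rewrite /S /upd drop0; repeat (case: eqP => ?); try lia.
rewrite Sb2 Sb in E5.
have -> : upd s b (para (fun a w acc => St a w acc e) (I e) (L e)) =
   upd (upd (S [::]) b.+2 [::]) b (R (L e)).
  rewrite /S drop0; apply: functional_extensionality => i; rewrite /upd.
  by repeat (case: eqP => ?); subst; try done; try lia.
apply: execB_le (execB_seq E1 (execB_seq E2 (execB_seq E3 (execB_seq E4 E5)))).
have : size (R (L e)) <= u e by apply: (Hu e [::]).
by lia.
Qed.

End PolynomialTimeFunctions.

(** * Truth values, unary numbers and scans as words *)

Fixpoint scan (G : Type) (phi : G -> seq G -> bool) (l : seq G) : bool :=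
  if l is a :: w then phi a w || scan phi w else false.

(** The blocks come in decreasing order of index, since [PT_natcat] obtains the index as the length
    of a suffix of a unary word. *)
Fixpoint natcat (T : Type) (f : nat -> seq T) (n : nat) (w : seq T) : seq T :=
  if n is k.+1 then f k ++ natcat f k w else w.

Section DerivedFunctions.
Variables (G : finType) (one : G).
Implicit Types (e : nat -> seq G) (f h : (nat -> seq G) -> seq G).
Implicit Types (P Q : (nat -> seq G) -> bool) (c : (nat -> seq G) -> nat).

(** Truth values and, below, unary numbers are themselves words, so that one notion of computability
    covers all three. *)
Definition PTb (n : nat) P : Prop := PT n (fun e => if P e then [:: one] else [::]).

Definition PTn (n : nat) c : Prop := PT n (fun e => nseq (c e) one).

(** If a step adds at most [u e] letters, growth is linear in the number of steps. This is the form
    in which the size condition of [PT_para] is verified throughout. *)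
Lemma PT_para_add n L I (St : G -> seq G -> seq G -> (nat -> seq G) -> seq G)
    (u : (nat -> seq G) -> nat) :
  PT n L -> PT n I ->
  (forall a, PT n.+2 (fun e => St a (e 0) (e 1) (fun i => e i.+2))) ->
  PB n u ->
  (forall e a w acc, size w <= size (L e) -> size (St a w acc e) <= size acc + u e) ->
  PT n (fun e => para (fun a w acc => St a w acc e) (I e) (L e)).
Proof.
move=> PL PI PS Pu Hu; have SL := PT_size PL; have SI := PT_size PI.
apply: (@PT_para _ n L I St (fun e => size (I e) + size (L e) * u e)) => //; first by pb.
move=> e l1 l2 E; have : size l2 <= size (L e) by rewrite E size_cat leq_addl.
have le m k : m <= k -> size (I e) + m * u e <= size (I e) + k * u e.
  by move=> mk; rewrite leq_add2l leq_mul2r mk orbT.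
move=> l2L; apply: leq_trans (le _ _ l2L).
elim: l2 {E} l2L => [|a w IH] /= lt; first by lia.
apply: leq_trans (Hu _ _ _ _ (ltnW lt)) _.
by rewrite mulSn addnCA addnC leq_add2l IH // ltnW.
Qed.

Lemma PT_const n (w : seq G) : PT n (fun _ => w).
Proof. by elim: w => [|a w IH]; [apply: PT_nil|apply: PT_cons]. Qed.

Lemma PT_cat n f h : PT n f -> PT n h -> PT n (fun e => f e ++ h e).
Proof.
move=> Pf Ph.
apply: (@PT_eq _ n (fun e => para (fun a w acc => a :: acc) (h e) (f e))).
  by move=> e; elim: (f e) => //= a w ->.
apply: (PT_para_add (St := fun a w acc e => a :: acc) (u := fun=> 1)) => // [a||].
- by apply: PT_cons; apply: PT_var.
- exact: PB_const.
- by move=> *; rewrite addn1.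
Qed.

Lemma PT_drop n f h : PT n f -> PT n h -> PT n (fun e => drop (size (f e)) (h e)).
Proof.
move=> Pf Ph.
apply: (@PT_eq _ n (fun e => para (fun a w acc => behead acc) (h e) (f e))).
  by move=> e; elim: (f e) => /= [|a w ->]; rewrite ?drop0 // -drop1 drop_drop add1n.
apply: (PT_para_add (St := fun a w acc e => behead acc) (u := fun=> 1)) => // [a||].
- by apply: PT_behead; apply: PT_var.
- exact: PB_const.
- by move=> *; rewrite size_behead; lia.
Qed.

Lemma PT_if n P f h : PTb n P -> PT n f -> PT n h ->
  PT n (fun e => if P e then f e else h e).
Proof.
move=> PP Pf Ph; have := PT_case (h := fun _ => f) PP Ph (fun _ => Pf).
by apply: PT_eq => e; case: (P e).
Qed.

Lemma PTb_const n b : PTb n (fun=> b).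
Proof. exact: PT_const. Qed.

Lemma PTb_and n P Q : PTb n P -> PTb n Q -> PTb n (fun e => P e && Q e).
Proof.
by move=> PP PQ; apply: PT_eq (PT_if PP PQ (PT_nil _ n)) => e; case: (P e).
Qed.

Lemma PTb_or n P Q : PTb n P -> PTb n Q -> PTb n (fun e => P e || Q e).
Proof.
by move=> PP PQ; apply: PT_eq (PT_if PP (PT_const n [:: one]) PQ) => e; case: (P e).
Qed.

Lemma PTb_not n P : PTb n P -> PTb n (fun e => ~~ P e).
Proof.
by move=> PP; apply: PT_eq (PT_if PP (PT_nil _ n) (PT_const n [:: one])) => e; case: (P e).
Qed.

Lemma PTb_head n f (p : pred (option G)) : PT n f -> PTb n (fun e => p (ohead (f e))).
Proof.
move=> Pf; have := PT_case (h := fun a _ => if p (Some a) then [:: one] else [::])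
  Pf (PT_const n (if p None then [:: one] else [::])) (fun a => PT_const n _).
by apply: PT_eq => e; case: (f e).
Qed.

Lemma PTb_nilp n f : PT n f -> PTb n (fun e => nilp (f e)).
Proof.
move=> Pf; apply: PT_eq (PTb_head (fun o => ~~ isSome o) Pf) => e.
by case: (f e).
Qed.

Lemma PTb_eqc n f (w : seq G) : PT n f -> PTb n (fun e => f e == w).
Proof.
elim: w f => [|a w IH] f Pf.
  by apply: PT_eq (PTb_nilp Pf) => e; case: (f e).
apply: PT_eq (PTb_and (PTb_head (pred1 (Some a)) Pf) (IH _ (PT_behead Pf))) => e.
by case: (f e) => //= b v; rewrite eqseq_cons (inj_eq Some_inj).
Qed.

Lemma PTn_size n f : PT n f -> PTn n (fun e => size (f e)).
Proof.
move=> Pf.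
apply: (@PT_eq _ n (fun e => para (fun a w acc => one :: acc) [::] (f e))).
  by move=> e; elim: (f e) => //= a w ->.
apply: (PT_para_add (St := fun a w acc e => one :: acc) (u := fun=> 1)) => // [|a||].
- exact: PT_nil.
- by apply: PT_cons; apply: PT_var.
- exact: PB_const.
- by move=> *; rewrite addn1.
Qed.

Lemma PTn_const n k : PTn n (fun=> k).
Proof. exact: PT_const. Qed.

Lemma PTn_add n c c' : PTn n c -> PTn n c' -> PTn n (fun e => c e + c' e).
Proof. by move=> Pc Pc'; apply: PT_eq (PT_cat Pc Pc') => e; rewrite nseqD. Qed.

Lemma PTn_succ n c : PTn n c -> PTn n (fun e => (c e).+1).
Proof. exact: PT_cons. Qed.

Lemma PTn_mul n c c' : PTn n c -> PTn n c' -> PTn n (fun e => c e * c' e).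
Proof.
move=> Pc Pc'.
apply: (@PT_eq _ n (fun e => para (fun a w acc => nseq (c' e) one ++ acc) [::] (nseq (c e) one))).
  by move=> e; elim: (c e) => //= m ->; rewrite mulSn nseqD.
have Sc' := PT_size Pc'.
apply: (PT_para_add (St := fun a w acc e => nseq (c' e) one ++ acc)
   (L := fun e => nseq (c e) one) (u := fun e => size (nseq (c' e) one))) => // [|a|].
- exact: PT_nil.
- by apply: PT_cat; [exact: PT_weak2 Pc'|apply: PT_var].
- by move=> *; rewrite size_cat addnC.
Qed.

Lemma PTn_poly n c (p : {poly nat}) : PTn n c -> PTn n (fun e => p.[c e]%R).
Proof.
move=> Pc; elim/poly_ind: p => [|p k IH].
  by apply: PT_eq (PTn_const n 0) => e; rewrite horner0.
by apply: PT_eq (PTn_add (PTn_mul IH Pc) (PTn_const n k)) => e; rewrite hornerMXaddC.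
Qed.

Lemma PT_dropn n c f : PTn n c -> PT n f -> PT n (fun e => drop (c e) (f e)).
Proof. by move=> Pc Pf; apply: PT_eq (PT_drop Pc Pf) => e; rewrite size_nseq. Qed.

Lemma PTb_leq n c c' : PTn n c -> PTn n c' -> PTb n (fun e => c e <= c' e).
Proof.
move=> Pc Pc'; apply: PT_eq (PTb_nilp (PT_dropn Pc' Pc)) => e.
by rewrite /nilp size_drop size_nseq subn_eq0.
Qed.

Lemma PTb_ltn n c c' : PTn n c -> PTn n c' -> PTb n (fun e => c e < c' e).
Proof. by move=> Pc; apply: PTb_leq; apply: PTn_succ. Qed.

Lemma PTb_eqn n c c' : PTn n c -> PTn n c' -> PTb n (fun e => c e == c' e).
Proof.
move=> Pc Pc'; apply: PT_eq (PTb_and (PTb_leq Pc Pc') (PTb_leq Pc' Pc)) => e.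
by rewrite -eqn_leq.
Qed.

Lemma PTb_scan n L (phi : G -> seq G -> (nat -> seq G) -> bool) :
  PT n L -> (forall a, PTb n.+1 (fun e => phi a (e 0) (fun i => e i.+1))) ->
  PTb n (fun e => scan (fun a w => phi a w e) (L e)).
Proof.
move=> PL Pphi.
apply: (@PT_eq _ n (fun e => para
  (fun a w acc => if phi a w e then [:: one] else acc) [::] (L e))).
  by move=> e; elim: (L e) => //= a w ->; case: (phi a w e).
apply: (PT_para_add (St := fun a w acc e => if phi a w e then [:: one] else acc)
   (u := fun=> 1)) => // [|a||].
- exact: PT_nil.
- apply: PT_if; [|exact: PT_const|exact: PT_var].
  apply: (PT_ren (sg := fun i => if i is j.+1 then j.+2 else 0) _ (Pphi a)).
  by case.
- exact: PB_const.
- by move=> *; case: ifP => //= _; rewrite addnC.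
Qed.

Lemma PT_natcat n c (h : nat -> (nat -> seq G) -> seq G) f :
  PTn n c -> PT n.+1 (fun e => h (size (e 0)) (fun i => e i.+1)) -> PT n f ->
  PT n (fun e => natcat (fun i => h i e) (c e) (f e)).
Proof.
move=> Pc Ph Pf.
apply: (@PT_eq _ n (fun e => para (fun a w acc => h (size w) e ++ acc) (f e) (nseq (c e) one))).
  by move=> e; elim: (c e) => //= m ->; rewrite size_nseq.
have [d Hd] := PT_size Ph; have Sc := PT_size Pc.
apply: (PT_para_add (L := fun e => nseq (c e) one) (St := fun a w acc e => h (size w) e ++ acc)
   (u := fun e => (size (nseq (c e) one) + esize n e + 2) ^ d)) => // [a||].
- apply: PT_cat; last exact: PT_var.
  apply: (PT_ren (sg := fun i => if i is j.+1 then j.+2 else 0) _ Ph).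
  by case.
- by pb.
- move=> e _ w acc lew; rewrite size_cat addnC leq_add2l.
  have := Hd (scons w e); rewrite /= esize_scons => le; apply: leq_trans le _.
  by case: (d) => // d'; rewrite leq_exp2r //; lia.
Qed.

End DerivedFunctions.

(** * Compilation to Turing machines *)

Section Compilation.
Variables (G : finType) (p : prog G) (r k : nat).
Hypothesis preg_lt : forall q : pstate p, preg q < k.+2.
Hypothesis r_lt : r < k.+2.

Local Notation tapes := ('I_k.+2 -> tape G).

Definition mstate : Type :=
  ((pstate p + option bool) * option (option ('I_k.+2 * G)))%type.

HB.instance Definition _ := Finite.on mstate.

Definition idle_act (rd : {ffun 'I_k.+2 -> option G}) :
    {ffun 'I_k.+2 -> option G * direction} := [ffun j => (rd j, Stay)].

Definition op_act (i : 'I_k.+2) (o : stack_op G) (rd : {ffun 'I_k.+2 -> option G}) :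
    {ffun 'I_k.+2 -> option G * direction} :=
  [ffun j => if j == i then
     match o with
     | Keep => (rd j, Stay) | Put _ => (rd j, MoveLeft) | Drop => (None, MoveRight)
     end else (rd j, Stay)].

(* A stack is a word on a tape with the head on its first letter. Pushing takes
   two steps, since a machine writes before it moves: the second component of
   a state is the letter still to be written. After the exit of the program,
   the state [inr (Some b)] records whether stack [r] is nonempty. *)
Definition mdelta (q : mstate) (rd : {ffun 'I_k.+2 -> option G}) :
    option (mstate * {ffun 'I_k.+2 -> option G * direction}) :=
  match q.2 with
  | Some o => Some ((q.1, None) : mstate, [ffun j =>
      if o is Some (i, a) then if j == i then (Some a, Stay) else (rd j, Stay)
      else (rd j, Stay)])
  | None =>
    match q.1 with
    | inl q' =>
        let i := inord (preg q') : 'I_k.+2 in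
        let: (o, n) := pact q' (rd i) in
        Some (((if n is Some q'' then inl q'' else inr None),
               Some (if o is Put a then Some (i, a) else None)) : mstate, op_act i o rd)
    | inr None =>
        Some ((inr (Some (isSome (rd (inord r)))), None) : mstate, idle_act rd)
    | inr (Some _) => None
    end
  end.

Definition pmachine : machine k.+2 G :=
  @Machine k.+2 G mstate (inl (pstart p), None) [set (inr (Some true), None)] mdelta.

Lemma tape_contains_read (t : tape G) w : tape_contains t w -> tape_read t = ohead w.
Proof. by move=> [i [j ->]]; case: w => //; case: j. Qed.

(** A machine writes at every step, which may turn an implicit blank into an explicit one; hence
    stacks are represented up to blank padding. *)
Lemma tape_contains_stay (t : tape G) w : tape_contains t w ->
  tape_contains (tape_write t (tape_read t)) w.
Proof.
move=> [i [j ->]]; case: w => [|a w]; last by exists i, j.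
by case: j => [|j]; [exists i, 1|exists i, j.+1].
Qed.

Lemma tape_contains_drop (t : tape G) w : tape_contains t w ->
  tape_contains (tape_move (tape_write t None) MoveRight) (behead w).
Proof.
move=> [i [j ->]]; case: w => [|a w]; last by exists i.+1, j.
by exists i.+1, j.-1; case: j.
Qed.

Lemma tape_contains_put (t : tape G) w a : tape_contains t w ->
  tape_contains (tape_write (tape_move (tape_write t (tape_read t)) MoveLeft) (Some a)) (a :: w).
Proof.
move/tape_contains_stay => [i [j ->]]; exists i.-1, j.
by case: i.
Qed.

Definition represents (t : tapes) (s : store G) : Prop :=
  forall i : 'I_k.+2, tape_contains (t i) (s i).

(** Every program step takes exactly two machine steps, the second one idle unless a letter is
    pushed; times are then simply doubled. *)
Lemma pmachine_step2 q (t : tapes) (s : store G) o n :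
  represents t s -> pact q (ohead (s (preg q))) = (o, n) ->
  exists2 t', represents t' (upd s (preg q) (apply_op o (s (preg q)))) &
    iter 2 (@tm_step _ _ pmachine) ((inl q, None), t) =
    (((if n is Some q' then inl q' else inr None), None), t').
Proof.
move=> R H; have Hi : (inord (preg q) : 'I_k.+2) = preg q :> nat by rewrite inordK.
rewrite /=; set c1 := tm_step (_, t).
have -> : c1 = (((if n is Some q' then inl q' else inr None),
   Some (if o is Put a then Some (inord (preg q), a) else None)),
   fun i => tape_move (tape_write (t i) (op_act (inord (preg q)) o [ffun i => tape_read (t i)] i).1)
     (op_act (inord (preg q)) o [ffun i => tape_read (t i)] i).2).
  rewrite /c1 /tm_step /tm_action /= /mdelta /= ffunE (tape_contains_read (R _)) Hi H.
  by [].
rewrite /tm_step /tm_action /= /mdelta /=; eexists; last by [].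
move=> j; rewrite !ffunE; have [Ej|ne] := eqVneq j (inord (preg q)); last first.
  have -> : upd s (preg q) (apply_op o (s (preg q))) j = s j.
    by rewrite /upd -Hi; case: eqP => // /val_inj /eqP; rewrite (negbTE ne).
  by case: o {H c1} => [|a|]; rewrite ?ffunE /= ?(negbTE ne) /= ?ffunE;
    do !apply: tape_contains_stay.
have -> : upd s (preg q) (apply_op o (s (preg q))) j = apply_op o (s j).
  by rewrite /upd Ej Hi eqxx.
case: o {H c1} => [|a|] /=; rewrite ?ffunE ?Ej ?eqxx /= ?ffunE.
- by do !apply: tape_contains_stay.
- exact: tape_contains_put.
- by apply: tape_contains_stay; apply: tape_contains_drop.
Qed.

Lemma pmachine_runs q s n s' (t : tapes) :
  runs q s n s' -> represents t s ->
  exists2 t', represents t' s' &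
    iter (2 * n) (@tm_step _ _ pmachine) ((inl q, None), t) = ((inr None, None), t').
Proof.
move=> H; elim: H t => [{}q {}s o H|{}q {}s o q' {}n {}s' H _ IH] t R.
  exact: (pmachine_step2 R H).
have [t1 /IH [t2 R2 E2] E1] := pmachine_step2 R H; exists t2 => //.
by rewrite mulnS addnC iterD E1.
Qed.

(** The additional step after the exit inspects stack [r]. The machine has then halted and its
    configuration is a fixed point, so any larger [m] gives the same result. *)
Lemma pmachine_exec s B s' (t : tapes) m :
  execB p s B s' -> represents t s -> 2 * B + 1 <= m ->
  exists2 t', represents t' s' &
    iter m (@tm_step _ _ pmachine) (tm_start pmachine, t) =
    ((inr (Some (isSome (ohead (s' r)))), None), t').
Proof.
move=> [n nB /pmachine_runs H] /H [t1 R1 E1] le.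
pose t' : tapes := fun i => tape_write (t1 i) (tape_read (t1 i)).
exists t'; first by move=> i; apply: tape_contains_stay.
have -> : m = (m - (2 * n + 1)) + (1 + 2 * n) by lia.
rewrite iterD (iterD 1) E1 /=.
have -> : tm_step (M := pmachine) ((inr None, None), t1) =
    ((inr (Some (isSome (ohead (s' r)))), None), t').
  rewrite /tm_step /tm_action /= /mdelta /= ffunE (tape_contains_read (R1 _)) inordK //.
  by congr (_, _); apply: functional_extensionality => i; rewrite !ffunE.
by elim: (m - _) => //= m' ->.
Qed.

End Compilation.

Lemma horner_time_bound (d n : nat) :
  (2%:P * ('X + 2%:P) ^+ d + 1%:P : {poly nat}).[n]%R = 2 * (n + 2) ^ d + 1.
Proof.
rewrite hornerD hornerM !hornerC horner_exp hornerD hornerX hornerC.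
by rewrite -natrXE.
Qed.

Lemma PTb_decidable (A C G : finType) (one : G) (iA : A -> G) (iC : C -> G)
    (chk : seq G -> seq G -> bool) :
  injective iA -> injective iC -> PTb one 2 (fun e => chk (e 0) (e 1)) ->
  polytime_decidable (fun x y => chk (map iA x) (map iC y)).
Proof.
move=> injA injC [_ [c [d H]]]; set p := c id 2 in H.
(* There is a tape for every stack of the program, and the successor ensures that stack 2, which
   holds the answer, has one too. *)
pose k := (\max_q @preg _ p q).+1.
have Hk (q : pstate p) : preg q < k.+2.
  by rewrite /k ltnS (leq_trans (leq_bigmax q)) // leqW.
have Hr : 2 < k.+2 by [].
exists k, G, iA, iC, (pmachine p 2 k), (2%:P * ('X + 2%:P) ^+ d + 1%:P)%R.
split=> // x y c0; rewrite /c0 horner_time_bound {c0}.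
pose s : store G := fun i => match i with 0 => map iA x | 1 => map iC y | _ => [::] end.
have [||t' _ E] := @pmachine_exec G p 2 k Hk Hr s
   ((size x + size y + 2) ^ d) (upd s 2 (if chk (map iA x) (map iC y) then [:: one] else [::]))
   (tm_init (pmachine p 2 k) (map iA x) (map iC y)).2 _ _ _ (leqnn _).
- have := H id 2 s; rewrite /esize !big_ord_recr big_ord0 /= !size_map add0n; apply => //.
  by case=> [|[|]].
- case=> -[|[|i]] lt /=; rewrite /represents /=.
  + by exists 0, 0; rewrite cats0.
  + by exists 0, 0; rewrite cats0.
  + by exists 0, 0.
rewrite /tm_init in E *; rewrite E /tm_halted /tm_action /= /mdelta /=; split=> //.
by rewrite inE /upd eqxx; case: (chk _ _).
Qed.

Lemma PT_computable (A B G : finType) (iA : A -> G) (iB : B -> G)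
    (F : seq G -> seq G) (f : seq A -> seq B) :
  injective iA -> injective iB -> PT 1 (fun e => F (e 0)) ->
  (forall x, F (map iA x) = map iB (f x)) -> polytime_computable f.
Proof.
move=> injA injB [_ [c [d H]]] Ff; set p := c id 1 in H.
pose k := (\max_q @preg _ p q).+1.
have Hk (q : pstate p) : preg q < k.+2.
  by rewrite /k ltnS (leq_trans (leq_bigmax q)) // leqW.
have Hr : 2 < k.+2 by [].
exists k, G, iA, iB, (pmachine p 2 k), (2%:P * ('X + 2%:P) ^+ d + 1%:P)%R.
split=> // x c0; rewrite /c0 horner_time_bound {c0}.
pose s : store G := fun i => if i is 0 then map iA x else [::].
have [||t' R E] := @pmachine_exec G p 2 k Hk Hr s
   ((size x + 2) ^ d) (upd s 1 (F (map iA x)))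
   (tm_init (pmachine p 2 k) (map iA x) [::]).2 _ _ _ (leqnn _).
- have := H id 1 s; rewrite /esize !big_ord_recr big_ord0 /= !size_map add0n; apply => //.
  by case.
- case=> -[|[|i]] lt /=; rewrite /represents /=.
  + by exists 0, 0; rewrite cats0.
  + by exists 0, 0.
  + by exists 0, 0.
rewrite /tm_init in E *; rewrite E /tm_halted /tm_action /= /mdelta /=; split=> //.
by have := R (inord 1); rewrite inordK // /upd eqxx Ff.
Qed.

(** * Reachable sets of labels *)

Fixpoint ceval (T : Type) (v : T -> bool) (phi : constraint T) : bool :=
  match phi with
  | AtLeastOne q => v q
  | Zero q => ~~ v q
  | Not psi => ~~ ceval v psi
  | And psi1 psi2 => ceval v psi1 && ceval v psi2
  | Or psi1 psi2 => ceval v psi1 || ceval v psi2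
  end.

Lemma eq_ceval (T : Type) (v v' : T -> bool) phi : v =1 v' -> ceval v phi = ceval v' phi.
Proof. by move=> E; elim: phi => //= [q|? ->|? -> ? ->|? -> ? ->] //; rewrite E. Qed.

Section GreedyLists.
Variable Q : finType.

Fixpoint good (J : seq Q -> Q -> bool) (l : seq Q) : bool :=
  if l is q :: w then J w q && good J w else true.

(** The list grows at its head, so an element is justified by those to its right. Each round adds a
    new element of [T], hence at most [#|T|] rounds are needed. *)
Lemma good_extension (J : seq Q -> Q -> bool) (T : {set Q}) (F : seq Q) :
  (forall l, {subset l <= T} -> ~~ (T \subset [set x in l ++ F]) ->
     exists q, [/\ q \in T, q \notin l ++ F & J l q]) ->
  exists l, [/\ uniq l, {subset l <= T}, good J l & T \subset [set x in l ++ F]].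
Proof.
move=> ext; suff H k l : uniq l -> {subset l <= T} -> good J l -> #|T| <= size l + k ->
    exists l, [/\ uniq l, {subset l <= T}, good J l & T \subset [set x in l ++ F]].
  by apply: (H #|T| [::]).
elim: k l => [|k IH] l Ul sl gl le.
  exists l; split=> //; rewrite addn0 in le.
  have sl' : [set x in l] \subset T by apply/subsetP => x; rewrite inE; apply: sl.
  have -> : T = [set x in l].
    apply/esym/eqP; rewrite eqEcard sl' /= (leq_trans le) //.
    by rewrite cardsE (card_uniqP Ul).
  by apply/subsetP => x; rewrite !inE mem_cat => ->.
have [sT|nsT] := boolP (T \subset [set x in l ++ F]); first by exists l.
have [q [qT ql Jq]] := ext l sl nsT; rewrite mem_cat negb_or in ql.
apply: (IH (q :: l)) => //=.
- by case/andP: ql => -> _.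
- by move=> x; rewrite inE => /orP[/eqP -> //|/sl].
- by rewrite Jq.
- by rewrite addSnnS.
Qed.

End GreedyLists.

(** * Label sets of reachable configurations *)

Section LabelReachability.
Variables (Q S : finType) (P : process Q S).

(** Edges are forgotten: since they can be rearranged before each broadcast, any set of potential
    receivers may be the one that hears it. *)
Inductive lstep (V : finType) (lab lab' : V -> Q) : Prop :=
  | LInternal (v : V) of (lab v, Internal, lab' v) \in rules P &
      forall u, u != v -> lab' u = lab u
  | LBroadcast (v : V) (a : S) of (lab v, Broadcast a, lab' v) \in rules P &
      forall u, u != v -> lab' u = lab u \/ (lab u, Receive a, lab' u) \in rules P.

Definition lreach (V : finType) : (V -> Q) -> (V -> Q) -> Prop :=
  clos_refl_trans (V -> Q) (@lstep V).

Definition labels (V : finType) (lab : V -> Q) : {set Q} := [set lab v | v in V].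

Lemma labelsP (V : finType) (lab : V -> Q) q :
  reflect (exists v, lab v = q) (q \in labels lab).
Proof.
by apply: (iffP imsetP) => [[v _ ->]|[v <-]]; exists v.
Qed.

Lemma transition_lreach (V : finType) (g g' : config Q V) :
  clos_refl_trans _ (transition P) g g' -> lreach (label g) (label g').
Proof.
elim=> [{}g {}g' [v rv H _|v a rv H1 H2 _|E]|{}g|{}g g1 {}g' _ IH1 _ IH2].
- by apply: rt_step; apply: LInternal rv H.
- apply: rt_step; apply: LBroadcast rv _ => u ne.
  have [e|ne'] := boolP (edge g v u); last by left; apply: H2.
  by move: (H1 u e); case: ifP => _; [right|move/eqP; left].
- have -> : label g' = label g by apply: functional_extensionality.
  exact: rt_refl.
- exact: rt_refl.
- exact: rt_trans IH1 IH2.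
Qed.

Lemma lreach_transition (V : finType) (lab lab' : V -> Q) : lreach lab lab' ->
  forall g : config Q V, label g = lab ->
  exists2 g' : config Q V, label g' = lab' & clos_refl_trans _ (transition P) g g'.
Proof.
elim=> [{}lab {}lab' [v rv H|v a rv H]|{}lab|{}lab lab1 {}lab' _ IH1 _ IH2] g Eg.
- exists (Config (@edge_sym _ _ g) (@edge_irr _ _ g) lab') => //.
  by apply: rt_step; apply: (@TransInternal _ _ _ _ _ _ v); rewrite /= ?Eg.
(* Before the broadcast the nodes move to a star around [v] whose leaves are exactly the nodes
   changing their labels; a node that could receive but keeps its label stays out of range. *)
- pose E u := (u != v) && (lab' u != lab u).
  pose ed : rel V := fun u w => (u == v) && E w || (w == v) && E u.
  have ed_sym : symmetric ed by move=> u w; rewrite /ed orbC.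
  have ed_irr : irreflexive ed by move=> u; rewrite /ed /E; case: eqP.
  have Ev : E v = false by rewrite /E eqxx.
  have edv u : ed v u = E u by rewrite /ed eqxx Ev andbF orbF.
  exists (Config ed_sym ed_irr lab') => //.
  apply: (@rt_trans _ _ _ (Config ed_sym ed_irr lab)); apply: rt_step.
    by apply: TransMove; rewrite /= Eg.
  apply: (@TransBroadcast _ _ _ _ _ _ v a) => //= u.
    rewrite edv => /andP[nuv /eqP ne]; case: (H u nuv) => // Hr.
    by case: existsP => // -[]; exists (lab' u).
  by move=> nuv; rewrite edv /E nuv /= negbK => /eqP.
- by exists g => //; apply: rt_refl.
- have [g1 E1 R1] := IH1 g Eg; have [g2 E2 R2] := IH2 g1 E1.
  by exists g2 => //; apply: rt_trans R1 R2.
Qed.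

Definition cov (A : {set Q}) : Prop :=
  exists (V : finType) (lab0 lab : V -> Q),
    [/\ forall v, lab0 v \in initials P, lreach lab0 lab & A = labels lab].

Lemma satisfies_ceval (V : finType) (g : config Q V) phi :
  satisfies g phi = ceval (mem (labels (label g))) phi.
Proof.
have H q : [exists v, label g v == q] = (q \in labels (label g)).
  by apply/existsP/labelsP => -[v E]; exists v; apply/eqP.
elim: phi => //= [q|? ->|? -> ? ->|? -> ? ->] //.
by rewrite -[_ \in _]H negb_exists.
Qed.

Lemma reaches_cov phi : reaches P phi <-> exists2 A, cov A & ceval (mem A) phi.
Proof.
split=> [[V [g0 [g [i0 R sat]]]]|[_ [V [lab0 [lab [i0 R ->]]]] sat]].
  exists (labels (label g)); last by rewrite -satisfies_ceval.
  by exists V, (label g0), (label g); split=> //; apply: transition_lreach.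
have s0 : symmetric (fun _ _ : V => false) by [].
have r0 : irreflexive (fun _ : V => fun _ : V => false) by [].
have [g Eg Rg] := lreach_transition R (g := Config s0 r0 lab0) erefl.
exists V, (Config s0 r0 lab0), g; split=> //.
by rewrite satisfies_ceval Eg.
Qed.

Definition labsum (V W : finType) (l1 : V -> Q) (l2 : W -> Q) : V + W -> Q :=
  fun v => match v with inl v1 => l1 v1 | inr v2 => l2 v2 end.

Lemma labels_sum (V W : finType) (l1 : V -> Q) (l2 : W -> Q) :
  labels (labsum l1 l2) = labels l1 :|: labels l2.
Proof.
apply/setP => q; rewrite inE; apply/labelsP/orP => [[[v|v] <-]|[/labelsP[v <-]|/labelsP[v <-]]].
- by left; apply/labelsP; exists v.
- by right; apply/labelsP; exists v.
- by exists (inl v).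
- by exists (inr v).
Qed.

Lemma lreach_sum (V W : finType) (l1 l1' : V -> Q) (l2 l2' : W -> Q) :
  lreach l1 l1' -> lreach l2 l2' -> lreach (labsum l1 l2) (labsum l1' l2').
Proof.
move=> R1 R2; apply: (@rt_trans _ _ _ (labsum l1' l2)).
  elim: R1 => [{}l1 {}l1' [v rv H|v a rv H]|{}l1|{}l1 l1'' {}l1' _ IH1 _ IH2].
  - apply: rt_step; apply: (@LInternal _ _ _ (inl v)) => // -[u|u] //= ne.
    by apply: H; apply: contraNneq ne => ->.
  - apply: rt_step; apply: (@LBroadcast _ _ _ (inl v) a) => // -[u|u] //= ne.
      by apply: H; apply: contraNneq ne => ->.
    by left.
  - exact: rt_refl.
  - exact: rt_trans IH1 IH2.
elim: R2 {R1} => [{}l2 {}l2' [v rv H|v a rv H]|{}l2|{}l2 l2'' {}l2' _ IH1 _ IH2].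
- apply: rt_step; apply: (@LInternal _ _ _ (inr v)) => // -[u|u] //= ne.
  by apply: H; apply: contraNneq ne => ->.
- apply: rt_step; apply: (@LBroadcast _ _ _ (inr v) a) => // -[u|u] //= ne.
    by left.
  by apply: H; apply: contraNneq ne => ->.
- exact: rt_refl.
- exact: rt_trans IH1 IH2.
Qed.

(* Two networks run side by side without any edge between them. *)
Lemma cov_union A B : cov A -> cov B -> cov (A :|: B).
Proof.
move=> [V [l0 [l [i0 R ->]]]] [W [m0 [m [j0 R' ->]]]].
exists (V + W)%type, (labsum l0 m0), (labsum l m); split.
- by case.
- exact: lreach_sum.
- by rewrite labels_sum.
Qed.

Lemma cov_set0 : cov set0.
Proof.
exists void, (of_void Q), (of_void Q); split=> [[]||]; first exact: rt_refl.
by apply/setP => q; rewrite inE; apply/esym/labelsP => -[[]].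
Qed.

Lemma cov_initial q : q \in initials P -> cov [set q].
Proof.
move=> iq; exists unit, (fun=> q), (fun=> q); split=> //; first exact: rt_refl.
by apply/setP => p; rewrite inE; apply/eqP/labelsP => [->|[_ ->]] //; exists tt.
Qed.

Lemma cov_lreach (V : finType) (lab0 lab lab' : V -> Q) :
  (forall v, lab0 v \in initials P) -> lreach lab0 lab -> lreach lab lab' -> cov (labels lab').
Proof. by move=> i0 R R'; exists V, lab0, lab'; split=> //; apply: rt_trans R R'. Qed.

(** * Adding and removing one state *)

Definition bcast (M : pred Q) (a : S) : bool :=
  [exists r in rules P, let: (s, x, t) := r in [&& x == Broadcast a, M s & M t]].

Definition triggered (M : pred Q) (x : action S) : bool :=
  if x is Receive a then bcast M a else true.

Definition okrule (M : pred Q) (fwd : bool) (q : Q) (r : rule Q S) : bool :=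
  let: (s, x, t) := r in
  [&& (if fwd then t else s) == q, M (if fwd then s else t) &
      triggered M x].

(* With [fwd], a rule leads from a state in [M] to [q]; otherwise, from [q] to
   a state in [M]. The broadcasts that trigger receptions stay inside [M]. *)
Definition justified (M : pred Q) (fwd : bool) (q : Q) : bool :=
  [exists r in rules P, okrule M fwd q r].

Lemma justifiedP (M : pred Q) fwd q :
  reflect (exists s x t, [/\ (s, x, t) \in rules P,
     (if fwd then t else s) = q, M (if fwd then s else t) &
     triggered M x]) (justified M fwd q).
Proof.
apply: (iffP exists_inP) => [[[[s x] t] r /and3P[/eqP E M1 B]]|[s [x [t [r E M1 B]]]]].
  by exists s, x, t; split.
by exists (s, x, t) => //=; rewrite E eqxx M1.
Qed.

Lemma bcastP (M : pred Q) a :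
  reflect (exists s t, [/\ (s, Broadcast a, t) \in rules P, M s & M t]) (bcast M a).
Proof.
apply: (iffP exists_inP) => [[[[s x] t] r /and3P[/eqP E M1 M2]]|[s [t [r M1 M2]]]].
  by exists s, t; rewrite -E; split.
by exists (s, Broadcast a, t); rewrite // eqxx M1.
Qed.

Lemma lstep_set (V : finType) (lab : V -> Q) v q :
  (lab v, Internal, q) \in rules P \/ (exists a, (lab v, Broadcast a, q) \in rules P) ->
  lstep lab (fun u => if u == v then q else lab u).
Proof.
case=> [r|[a r]]; [apply: (@LInternal _ _ _ v)|apply: (@LBroadcast _ _ _ v a)];
  rewrite ?eqxx // => u /negbTE -> //; by left.
Qed.

(** It is enough to reach some subset of [q |: A] that contains [q]: the union with an untouched
    network restores the states lost on the way. *)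
Lemma cov_forward (A : {set Q}) q : cov A -> justified (mem A) true q -> cov (q |: A).
Proof.
move=> cA /justifiedP[s [x [t [r /= <- sA B]]]]; move: (cA) => [V [l0 [l [i0 R EA]]]].
have [v Ev] : exists v, l v = s by apply/labelsP; rewrite -EA.
suff [A' cA' [tA' sA']] : exists2 A', cov A' & t \in A' /\ A' \subset t |: A.
  suff -> : t |: A = A :|: A' by exact: cov_union.
  apply/setP => p; rewrite !inE; apply/idP/idP => [/orP[/eqP ->|->] //|/orP[->|]].
  - by rewrite tA' orbT.
  - by rewrite orbT.
  - by move/(subsetP sA'); rewrite !inE.
have simple : (s, Internal, t) \in rules P \/ (exists a, (s, Broadcast a, t) \in rules P) ->
    exists2 A', cov A' & t \in A' /\ A' \subset t |: A.
  rewrite -Ev => /lstep_set H; exists (labels (fun u => if u == v then t else l u)).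
    by apply: cov_lreach i0 R _; apply: rt_step.
  split; first by apply/labelsP; exists v; rewrite eqxx.
  apply/subsetP => p /labelsP[u <-]; case: (u =P v) => _; rewrite !inE ?eqxx // EA.
  by apply/orP; right; apply/labelsP; exists u.
case: x r B => [a|a|] r B; last by apply: simple; left.
  by apply: simple; right; exists a.
have [s' [t' [r' s'A t'A]]] := bcastP _ _ B.
have [v' Ev'] : exists v, l v = s' by apply/labelsP; rewrite -EA.
(* Sender and receiver are taken in different copies, because [s] and [s'] may coincide and occur at
   a single node. *)
pose lab' := labsum (fun u => if u == v' then t' else l u) (fun u => if u == v then t else l u).
exists (labels lab').
  apply: (@cov_lreach _ (labsum l0 l0) (labsum l l)); first by case.
    exact: lreach_sum.
  apply: rt_step; apply: (@LBroadcast _ _ _ (inl v') a); rewrite /= ?eqxx ?Ev' //.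
  case=> u /= ne; first by left; rewrite ifN //; apply: contraNneq ne => ->.
  by case: eqP => [->|_]; [right; rewrite Ev|left].
split; first by apply/labelsP; exists (inr v); rewrite /= eqxx.
have lA u : l u \in t |: A by rewrite inE EA orbC; apply/orP; left; apply/labelsP; exists u.
apply/subsetP => p; rewrite labels_sum => /setUP[] /labelsP[u <-].
  by case: (u =P v') => _ //; apply/setUP; right; exact: t'A.
by case: (u =P v) => _ //; rewrite !inE eqxx.
Qed.

Lemma lreach_move_all (V : finType) (lab : V -> Q) q t :
  (q, Internal, t) \in rules P \/ (exists a, (q, Broadcast a, t) \in rules P) ->
  lreach lab (fun u => if lab u == q then t else lab u).
Proof.
(* The nodes take the rule one after the other; if it is a broadcast, nobody listens. *)
move=> r; have H (vs : seq V) : lreach lab (fun u => if (u \in vs) && (lab u == q) then t else lab u).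
  elim: vs => [|v vs IH]; first by apply: rt_refl.
  have [nE|] := boolP ((v \notin vs) && (lab v == q)); last first.
    rewrite negb_and negbK => E; apply: eq_ind _ (lreach lab) IH _ _.
    apply: functional_extensionality => u; rewrite inE.
    by case: (u =P v) => [->|//]; case: (v \in vs) E => //= /negbTE ->.
  case/andP: nE => nv /eqP Ev; apply: rt_trans IH _; apply: rt_step.
  set l1 := (fun u => _).
  have El1 : l1 v = q by rewrite /l1 (negbTE nv).
  rewrite -El1 in r; apply: eq_ind _ (lstep l1) (lstep_set r) _ _.
  apply: functional_extensionality => u; rewrite inE /l1.
  by case: (u =P v) => [->|//]; rewrite Ev eqxx.
apply: eq_ind _ (lreach lab) (H (enum V)) _ _.
by apply: functional_extensionality => u; rewrite mem_enum.
Qed.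

(** All nodes in state [q] leave it for [t], which is in [A]. With a reception, a single broadcast
    empties [q] in two copies of the network. *)
Lemma cov_backward (A : {set Q}) q : q \notin A -> cov (q |: A) -> justified (mem A) false q -> cov A.
Proof.
move=> qA [V [l0 [l [i0 R EA]]]] /justifiedP[s [x [t [r /= Es tA B]]]]; rewrite {s}Es in r.
pose sub p := if p == q then t else p.
have lA p : p \in A -> exists2 v, l v = p & sub (l v) = p.
  move=> pA; have /labelsP[v Ev] : p \in labels l by rewrite -EA !inE pA orbT.
  by exists v; rewrite // /sub Ev ifN //; apply: contraNneq qA => <-.
have subA v : sub (l v) \in A.
  have : l v \in q |: A by rewrite EA; apply/labelsP; exists v.
  by rewrite /sub !inE; case: eqP => //= _ _; exact: tA.
have simple : (q, Internal, t) \in rules P \/ (exists a, (q, Broadcast a, t) \in rules P) -> cov A.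
  move=> H; suff -> : A = labels (fun u => sub (l u)).
    by apply: cov_lreach i0 R _; apply: lreach_move_all.
  apply/setP => p; apply/idP/labelsP => [/lA[v _ Ev]|[v <-]]; first by exists v.
  exact: subA.
case: x r B => [a|a|] r B; last by apply: simple; left.
  by apply: simple; right; exists a.
have [s' [t' [r' s'A t'A]]] := bcastP _ _ B; have [v' Ev' _] := lA _ s'A.
(* The sender sits in the second copy. The first one keeps a node in the sender's state [s'], which
   would be lost if [v'] were its only node. *)
pose lab' := labsum (fun u => sub (l u)) (fun u => if u == v' then t' else sub (l u)).
suff -> : A = labels lab'.
  apply: (@cov_lreach _ (labsum l0 l0) (labsum l l)); first by case.
    exact: lreach_sum.
  apply: rt_step; apply: (@LBroadcast _ _ _ (inr v') a); rewrite /= ?eqxx ?Ev' //.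
  have H u : sub (l u) = l u \/ (l u, Receive a, sub (l u)) \in rules P.
    by rewrite /sub; case: eqP => [->|_]; [right|left].
  case=> u ne /=; first exact: H.
  by rewrite ifN; [exact: H|apply: contraNneq ne => ->].
rewrite labels_sum; apply/setP => p; apply/idP/setUP => [/lA[v _ Ev]|[] /labelsP[v <-]].
- by left; apply/labelsP; exists v.
- exact: subA.
- by case: eqP => _; [exact: t'A|exact: subA].
Qed.

(* [l] lists the states of a run in the order of their first occurrence, most
   recent first; [F] contains those of the last configuration, and [m] the
   others, in the order of their last occurrence, earliest first. *)
Definition certificate (phi : constraint Q) (l F m : seq Q) : Prop :=
  [/\ good (fun w q => (q \in initials P) || justified (mem w) true q) l,
      {subset F ++ m <= l}, {subset l <= m ++ F},
      good (fun w q => justified (mem (w ++ F)) false q) m &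
      ceval (mem F) phi].

Lemma eq_justified (M M' : pred Q) fwd q :
  M =1 M' -> justified M fwd q = justified M' fwd q.
Proof. by move=> /functional_extensionality ->. Qed.

Lemma certificate_reaches phi l F m : certificate phi l F m -> reaches P phi.
Proof.
move=> [gl sub1 sub2 gm sat]; apply/reaches_cov; exists [set x in F]; last first.
  by rewrite (eq_ceval phi (_ : _ =1 mem F)) // => q; rewrite /= inE.
have : cov [set x in m ++ F].
  have -> : [set x in m ++ F] = [set x in l].
    apply/setP => x; rewrite !inE; apply/idP/idP; last exact: sub2.
    by rewrite mem_cat orbC -mem_cat; apply: sub1.
  elim: l gl {sub1 sub2} => [|q w IH] /=.
    by move=> _; rewrite (_ : [set x in [::]] = set0); [exact: cov_set0|apply/setP => x; rewrite !inE].
  move=> /andP[J /IH cw].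
  have -> : [set x in q :: w] = q |: [set x in w] by apply/setP => x; rewrite !inE.
  case/orP: J => [/cov_initial H|J]; first exact: cov_union.
  apply: cov_forward => //; rewrite (eq_justified _ _ (_ : _ =1 mem w)) // => x.
  by rewrite /= inE.
elim: m gm {sub1 sub2} => [|q w IH] //= /andP[J gw] c; apply: IH => //.
have E : [set x in q :: w ++ F] = q |: [set x in w ++ F] by apply/setP => x; rewrite !inE.
(* Repetitions are allowed in a certificate; if [q] still occurs further on, there is nothing to
   remove yet. *)
rewrite E in c; have [qin|qnin] := boolP (q \in [set x in w ++ F]).
  by rewrite setUC (setUidPl _) ?sub1set in c.
apply: cov_backward c _ => //.
by rewrite (eq_justified _ _ (_ : _ =1 mem (w ++ F))) // => x; rewrite /= inE.
Qed.

Fixpoint run (V : finType) (lab : V -> Q) (s : seq (V -> Q)) : Prop :=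
  if s is lab' :: s' then lstep lab lab' /\ run lab' s' else True.

Lemma lreach_run (V : finType) (lab lab' : V -> Q) :
  lreach lab lab' -> exists2 s, run lab s & last lab s = lab'.
Proof.
elim=> [x y H|x|x y z _ [s1 R1 <-] _ [s2 R2 <-]].
- by exists [:: y].
- by exists [::].
- exists (s1 ++ s2); last by rewrite last_cat.
  by elim: s1 x R1 R2 => //= a s1 IH x [H R1] R2; split=> //; apply: IH.
Qed.

Definition run_labels (V : finType) (lab : V -> Q) (s : seq (V -> Q)) : {set Q} :=
  \bigcup_(l <- lab :: s) labels l.

(** The step into the first configuration with a label outside [B]. *)
Lemma run_forward (V : finType) (lab : V -> Q) s (B : {set Q}) :
  run lab s -> labels lab \subset B -> ~~ (run_labels lab s \subset B) ->
  exists l l' : V -> Q, [/\ lstep l l', labels l \subset B, labels l' \subset run_labels lab s &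
                   ~~ (labels l' \subset B)].
Proof.
rewrite /run_labels; elim: s lab => [|l' s IH] lab /=.
  by rewrite big_cons big_nil setU0 => _ ->.
move=> [H R] sB; rewrite big_cons subUset sB /= => ns.
have [s'|ns'] := boolP (labels l' \subset B); last first.
  by exists lab, l'; split=> //; rewrite !big_cons; apply: subsetU; rewrite subsetUl orbT.
have [l [l2 [H1 H2 H3 H4]]] := IH _ R s' ns; exists l, l2; split=> //.
by apply: subsetU; rewrite H3 orbT.
Qed.

(** The step out of the last configuration with a label outside [B]. *)
Lemma run_backward (V : finType) (lab : V -> Q) s (B : {set Q}) :
  run lab s -> labels (last lab s) \subset B -> ~~ (run_labels lab s \subset B) ->
  exists l l' : V -> Q, [/\ lstep l l', labels l' \subset B, labels l \subset run_labels lab s &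
                   ~~ (labels l \subset B)].
Proof.
rewrite /run_labels; elim: s lab => [|l' s IH] lab /=.
  by rewrite big_cons big_nil setU0 => _ ->.
move=> [H R] sB; rewrite big_cons subUset negb_and.
have [s'|ns'] := boolP (\bigcup_(l <- l' :: s) labels l \subset B).
  rewrite orbF => ns; exists lab, l'; split=> //; last by rewrite subsetUl.
  by apply: subset_trans s'; rewrite big_cons subsetUl.
have [l [l2 [H1 H2 H3 H4]]] := IH _ R sB ns'; exists l, l2; split=> //.
by apply: subsetU; rewrite H3 orbT.
Qed.

Lemma labels_mem (V : finType) (lab : V -> Q) (B : {set Q}) v :
  labels lab \subset B -> lab v \in B.
Proof. by move/subsetP; apply; apply/labelsP; exists v. Qed.

Lemma reaches_certificate phi : reaches P phi ->
  exists l F m, [/\ uniq l, uniq F, uniq m & certificate phi l F m].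
Proof.
move/reaches_cov => [_ [V [lab0 [lab [i0 /lreach_run[s R El] ->]]]] sat].
set T := run_labels lab0 s.
have T0 : labels lab0 \subset T by rewrite /T /run_labels big_cons subsetUl.
have TF : labels lab \subset T.
  rewrite -El /T /run_labels; elim: (s) (lab0) => [|l' s' IH] l0 /=.
    by rewrite big_cons subsetUl.
  by rewrite big_cons; apply: subsetU; rewrite IH orbT.
have [l [Ul sl gl Tl]] : exists l, [/\ uniq l, {subset l <= T},
    good (fun w q => (q \in initials P) || justified (mem w) true q) l &
    T \subset [set x in l ++ [::]]].
  apply: good_extension => l; rewrite cats0 => sl ns; set B := [set x in l] in ns *.
  have [s0|/subsetPn[q /labelsP[v <-] qB]] := boolP (labels lab0 \subset B); last first.
    exists (lab0 v); rewrite i0; split=> //; last by rewrite inE in qB.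
    exact: labels_mem.
  have [l1 [l2 [st s1 s2 /subsetPn[q /labelsP[u Eu] qB]]]] := run_forward R s0 ns.
  have inB p : (p \in l) = (p \in B) by rewrite inE.
  suff [p [pT pB J]] : exists p, [/\ p \in T, p \notin B & justified (mem l) true p].
    by exists p; rewrite inB J orbT.
  have simple v x : (l1 v, x, l2 v) \in rules P -> l2 v \notin B ->
      triggered (mem l) x ->
      exists p, [/\ p \in T, p \notin B & justified (mem l) true p].
    move=> r nB Hx; exists (l2 v); split=> //; first exact: labels_mem.
    apply/justifiedP; exists (l1 v), x, (l2 v); split=> //=.
    by rewrite inB; apply: labels_mem.
  case: st => [v r H|v a r H].
    have [Ev|/H E] := eqVneq u v; first by apply: simple r _ _; rewrite // -Ev Eu.
    by rewrite -Eu E labels_mem in qB.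
  (* If the sender itself enters a new state, that state is chosen, by the sender's own rule.
     Otherwise the broadcast stays inside [B] and may justify the reception. *)
  have [vB|/(simple _ _ r)] := boolP (l2 v \in B); last by apply.
  have [Ev|/H [E|r']] := eqVneq u v; first by rewrite -Eu Ev vB in qB.
    by rewrite -Eu E labels_mem in qB.
  apply: simple r' _ _; first by rewrite Eu.
  apply/bcastP; exists (l1 v), (l2 v); split=> //=; rewrite inB //.
  exact: labels_mem.
pose F := enum (labels lab).
have [m [Um sm gm Tm]] : exists m, [/\ uniq m, {subset m <= T},
    good (fun w q => justified (mem (w ++ F)) false q) m & T \subset [set x in m ++ F]].
  apply: good_extension => m sm ns; set B := [set x in m ++ F] in ns *.
  have sF : labels (last lab0 s) \subset B.
    by apply/subsetP => p; rewrite El inE mem_cat mem_enum => ->; rewrite orbT.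
  have [l1 [l2 [st s2 s1 /subsetPn[q /labelsP[u Eu] qB]]]] := run_backward R sF ns.
  have inB p : (p \in m ++ F) = (p \in B) by rewrite inE.
  suff [p [pT pB J]] : exists p, [/\ p \in T, p \notin B & justified (mem (m ++ F)) false p].
    by exists p; rewrite inB.
  have simple v x : (l1 v, x, l2 v) \in rules P -> l1 v \notin B ->
      triggered (mem (m ++ F)) x ->
      exists p, [/\ p \in T, p \notin B & justified (mem (m ++ F)) false p].
    move=> r nB Hx; exists (l1 v); split=> //; first exact: labels_mem.
    apply/justifiedP; exists (l1 v), x, (l2 v); split=> //=.
    by rewrite inB; apply: labels_mem.
  case: st => [v r H|v a r H].
    have [Ev|/H E] := eqVneq u v; first by apply: simple r _ _; rewrite // -Ev Eu.
    by rewrite -Eu -E labels_mem in qB.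
  (* Dually, if the sender comes from a missing state, that state is the one eliminated. *)
  have [vB|/(simple _ _ r)] := boolP (l1 v \in B); last by apply.
  have [Ev|/H [E|r']] := eqVneq u v; first by rewrite -Eu Ev vB in qB.
    by rewrite -Eu -E labels_mem in qB.
  apply: simple r' _ _; first by rewrite Eu.
  apply/bcastP; exists (l1 v), (l2 v); split=> //=; rewrite inB //.
  exact: labels_mem.
have inT p : p \in T -> p \in l by move/(subsetP Tl); rewrite inE cats0.
exists l, F, m; split=> //; first exact: enum_uniq.
split=> //.
- move=> p; rewrite mem_cat => /orP[|/sm /inT //].
  by rewrite mem_enum => /(subsetP TF)/inT.
- by move=> p /sl /(subsetP Tm); rewrite inE.
- by rewrite (eq_ceval phi (_ : _ =1 mem (labels lab))) // => p; rewrite /= mem_enum.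
Qed.

End LabelReachability.

(** * A polynomial-time verifier *)

(* Boolean equality that computes, unlike the one transported from ['I_11]. *)
Definition teqb (a b : token) : bool :=
  match a, b with
  | TOne, TOne | TEnd, TEnd | TBroadcast, TBroadcast | TReceive, TReceive
  | TInternal, TInternal | TInitial, TInitial | TAtLeastOne, TAtLeastOne
  | TZero, TZero | TNot, TNot | TAnd, TAnd | TOr, TOr => true
  | _, _ => false
  end.

Lemma teqbP a b : reflect (a = b) (teqb a b).
Proof. by case: a; case: b; constructor. Qed.

Definition hd (w : seq token) (a : token) : bool := if w is b :: _ then teqb b a else false.

Definition weqb : seq token -> seq token -> bool := all2 teqb.

(** The tags of the states in [m ++ F], which are the possible targets of an elimination. *)
Definition elim_tag (a : token) : bool := teqb a TInternal || teqb a TAtLeastOne.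

Definition cnt (w : seq token) : nat := find (fun a => ~~ teqb a TOne) w.

Definition aft (w : seq token) : seq token := behead (drop (cnt w) w).

Lemma cnt_encode k w : cnt (encode_nat k ++ w) = k.
Proof. by rewrite /cnt; elim: k => //= k ->. Qed.

Lemma aft_encode k w : aft (encode_nat k ++ w) = w.
Proof.
by rewrite /aft cnt_encode /encode_nat cat_rcons drop_size_cat ?size_nseq.
Qed.

Definition isdelim (w : seq token) : bool := hd (drop (cnt w) w) TEnd.

Lemma isdelimP w : isdelim w -> w = encode_nat (cnt w) ++ aft w.
Proof.
rewrite /isdelim /aft /cnt; elim: w => //= a w IH.
case: teqbP => [->|_] /= E; first by rewrite [w in LHS]IH.
by case/teqbP: E => ->; rewrite ?drop0.
Qed.

(** A fact is read off wherever its tag occurs. The syntax of a certificate is not checked, since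
    only the numbers read from it matter. *)
Definition fact (tg : pred token) (w : seq token) (k : nat) : bool :=
  scan (fun a v => tg a && (cnt v == k)) w.

Definition sbcast (x : seq token) (tg : pred token) (w : seq token) (a : nat) : bool :=
  scan (fun t v => teqb t TBroadcast &&
    [&& cnt (aft v) == a, fact tg w (cnt v) & fact tg w (cnt (aft (aft v)))]) x.

Definition sjust (x : seq token) (tg : pred token) (w : seq token) (fwd : bool)
    (q : nat) : bool :=
  let ok s t := ((if fwd then t else s) == q) && fact tg w (if fwd then s else t) in
  scan (fun t v => match t with
    | TInternal => ok (cnt v) (cnt (aft v))
    | TBroadcast => ok (cnt v) (cnt (aft (aft v)))
    | TReceive => ok (cnt v) (cnt (aft (aft v))) && sbcast x tg w (cnt (aft v))
    | _ => false
    end) x.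

(* The certificate is a word of facts [t 1^q]: with tag [TInitial], that [q]
   occurs in the run; with [TAtLeastOne], that it occurs in the last
   configuration; with [TInternal], that it can be eliminated. Each fact is
   justified by the rules in [x] and the facts to its right. *)
Definition okfact (x : seq token) (t : token) (w : seq token) : bool :=
  match t with
  | TInitial => fact (teqb TInitial) x (cnt w) || sjust x (teqb TInitial) w true (cnt w)
  | TAtLeastOne => fact (teqb TInitial) w (cnt w)
  | TInternal => fact (teqb TInitial) w (cnt w) &&
      sjust x elim_tag w false (cnt w)
  | _ => true
  end.

Definition facts_ok (x y : seq token) : bool := ~~ scan (fun t w => ~~ okfact x t w) y.

Definition facts_total (y : seq token) : bool :=
  ~~ scan (fun t w => teqb t TInitial && ~~ fact elim_tag y (cnt w)) y.

Definition isnum (n : nat) (w : seq token) : bool := (cnt w < n) && isdelim w.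

(** True also at the end of the word. As [chk] passes over digits, this test after each item is what
    excludes stray ones. *)
Definition at_tag (w : seq token) : bool :=
  ~~ hd w TOne && ~~ hd w TEnd.

Definition okargs (n m : nat) (a : token) (w : seq token) : bool :=
  match a with
  | TOne | TEnd => true
  | TAtLeastOne | TZero | TInitial => isnum n w && at_tag (aft w)
  | TNot | TAnd | TOr => at_tag w
  | TInternal => [&& isnum n w, isnum n (aft w) & at_tag (aft (aft w))]
  | TBroadcast | TReceive =>
      [&& isnum n w, isnum m (aft w), isnum n (aft (aft w)) & at_tag (aft (aft (aft w)))]
  end.

Definition bit (b : bool) : token := if b then TOne else TEnd.

(* Reading from the right, the word consists of complete constraints
   ([TAnd] followed by their values), then initial states ([TInitial]), then
   rules ([TBroadcast]). *)
Definition fin (acc : seq token) : bool :=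
  [|| weqb acc [:: TAnd; TOne], weqb acc [:: TInitial] | weqb acc [:: TBroadcast]].

(** Prefix notation read from the right is evaluated with a stack of truth values, so parsing and
    evaluation are a single recursion on words. The empty accumulator signals failure, and every
    step preserves it. *)
Definition chk_step (v : nat -> bool) (a : token) (w acc : seq token) : seq token :=
  let b1 := hd (behead acc) TOne in
  let b2 := hd (behead (behead acc)) TOne in
  match a with
  | TOne | TEnd => acc
  | TAtLeastOne =>
      if hd acc TAnd then TAnd :: bit (v (cnt w)) :: behead acc else [::]
  | TZero =>
      if hd acc TAnd then TAnd :: bit (~~ v (cnt w)) :: behead acc else [::]
  | TNot => if hd acc TAnd && (1 < size acc)
      then TAnd :: bit (~~ b1) :: behead (behead acc) else [::]
  | TAnd => if hd acc TAnd && (2 < size acc)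
      then TAnd :: bit (b1 && b2) :: behead (behead (behead acc)) else [::]
  | TOr => if hd acc TAnd && (2 < size acc)
      then TAnd :: bit (b1 || b2) :: behead (behead (behead acc)) else [::]
  | TInitial =>
      if weqb acc [:: TAnd; TOne] || weqb acc [:: TInitial] then [:: TInitial] else [::]
  | TInternal | TBroadcast | TReceive => if fin acc then [:: TBroadcast] else [::]
  end.

Definition chk (n m : nat) (v : nat -> bool) (x : seq token) : seq token :=
  para (fun a w acc => if okargs n m a w then chk_step v a w acc else [::]) [:: TAnd] x.

Definition wfx (x y : seq token) : bool :=
  [&& isdelim x, isdelim (aft x), at_tag (aft (aft x)) &
      fin (chk (cnt x) (cnt (aft x)) (fact (teqb TAtLeastOne) y) (aft (aft x)))].

Definition check (x y : seq token) : bool :=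
  [&& wfx x y, facts_ok x y & facts_total y].

Lemma isnumP n w : isnum n w -> exists2 q : 'I_n, w = encode_nat q ++ aft w & cnt w = q.
Proof. by case/andP => lt /isdelimP E; exists (Ordinal lt). Qed.

(** * Parsing an instance and evaluating its constraint *)

Section WellFormedness.
Variables (n m : nat) (v : nat -> bool).

Let v' (q : 'I_n) : bool := v q.
Local Notation inits qs := (flatten (map (@encode_initial n) qs)).
Local Notation rls rs := (flatten (map (@encode_rule n m) rs)).

Lemma chk_cons a w :
  chk n m v (a :: w) = if okargs n m a w then chk_step v a w (chk n m v w) else [::].
Proof. by []. Qed.

Lemma chk_nat k w : chk n m v (encode_nat k ++ w) = chk n m v w.
Proof. by elim: k. Qed.

Lemma at_tag_constraint (f : constraint 'I_n) w : at_tag (encode_constraint f ++ w).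
Proof. by case: f. Qed.

Lemma isdelim_encode j w : isdelim (encode_nat j ++ w).
Proof.
by rewrite /isdelim cnt_encode /encode_nat cat_rcons drop_size_cat ?size_nseq.
Qed.

Lemma isnum_encode k j w : j < k -> isnum k (encode_nat j ++ w).
Proof.
by move=> lt; rewrite /isnum cnt_encode lt isdelim_encode.
Qed.

Lemma bit_eq b : teqb (bit b) TOne = b.
Proof. by case: b. Qed.

Lemma chk_constraint (f : constraint 'I_n) w st : at_tag w -> chk n m v w = TAnd :: st ->
  chk n m v (encode_constraint f ++ w) = TAnd :: bit (ceval v' f) :: st.
Proof.
elim: f w st => [q|q|f IH|f1 IH1 f2 IH2|f1 IH1 f2 IH2] w st sw E;
  rewrite [encode_constraint _]/= cat_cons chk_cons /=.
- by rewrite isnum_encode // aft_encode sw chk_nat E cnt_encode.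
- by rewrite isnum_encode // aft_encode sw chk_nat E cnt_encode.
- by rewrite at_tag_constraint (IH _ st) //= bit_eq.
- rewrite -catA at_tag_constraint (IH1 _ (bit (ceval v' f2) :: st)) ?at_tag_constraint //=.
    by rewrite !bit_eq.
  exact: IH2.
- rewrite -catA at_tag_constraint (IH1 _ (bit (ceval v' f2) :: st)) ?at_tag_constraint //=.
    by rewrite !bit_eq.
  exact: IH2.
Qed.

Lemma at_tag_inits qs (f : constraint 'I_n) : at_tag (inits qs ++ encode_constraint f).
Proof. by case: qs => //=; rewrite -[encode_constraint f]cats0 at_tag_constraint. Qed.

Lemma at_tag_rules rs qs (f : constraint 'I_n) :
  at_tag (rls rs ++ inits qs ++ encode_constraint f).
Proof.
by case: rs => [|[[q x] q'] rs] /=; [exact: at_tag_inits|case: x].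
Qed.

Lemma chk_complete rs qs f : ceval v' f ->
  fin (chk n m v (rls rs ++ inits qs ++ encode_constraint f)).
Proof.
move=> sat.
have Ef : chk n m v (encode_constraint f) = [:: TAnd; TOne].
  by rewrite -[encode_constraint f]cats0 (chk_constraint f (w := [::]) (st := [::])) // sat.
have Ei : chk n m v (inits qs ++ encode_constraint f) =
    if qs is [::] then [:: TAnd; TOne] else [:: TInitial].
  elim: qs => //= q qs IH; rewrite -catA chk_cons /= isnum_encode // aft_encode at_tag_inits.
  by rewrite chk_nat IH; case: (qs).
elim: rs => [|r rs IH]; first by rewrite /= Ei; case: (qs).
rewrite /= -catA.
by case: r => [[q [a|a|]] q'] /=; rewrite -!catA chk_cons /= !aft_encode
  !isnum_encode // at_tag_rules !chk_nat IH.
Qed.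

(** What a nonempty accumulator tells about the suffix already read. Several constraints may be
    pending at first; once an initial state or a rule has been read, exactly one was there, and it
    was true. *)
Variant described : seq token -> seq token -> Prop :=
  | DescribedF fs : described (flatten (map (@encode_constraint n) fs))
      (TAnd :: map (fun f => bit (ceval v' f)) fs)
  | DescribedI qs f of ceval v' f : described (inits qs ++ encode_constraint f) [:: TInitial]
  | DescribedR rs qs f of ceval v' f :
      described (rls rs ++ inits qs ++ encode_constraint f) [:: TBroadcast].

Lemma described_fin w acc : described w acc -> fin acc ->
  exists rs qs f, ceval v' f /\ w = rls rs ++ inits qs ++ encode_constraint f.
Proof.
case=> [[|f [|f' fs]]|qs f sat|rs qs f sat] //=.
- case E: (ceval v' f) => // _; exists [::], [::], f; split=> //=.
  by rewrite cats0.
- by case: bit.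
- by exists [::], qs, f.
- by exists rs, qs, f.
Qed.

Lemma described_initial w acc : described w acc ->
  weqb acc [:: TAnd; TOne] || weqb acc [:: TInitial] ->
  exists qs f, ceval v' f /\ w = inits qs ++ encode_constraint f.
Proof.
case=> [[|f [|f' fs]]|qs f sat|rs qs f sat] //=.
- case E: (ceval v' f) => // _; exists [::], f; split=> //=.
  by rewrite cats0.
- by case: bit.
- by exists qs, f.
Qed.

Lemma described_formulas w acc : described w acc -> hd acc TAnd ->
  exists2 fs, w = flatten (map (@encode_constraint n) fs) &
    acc = TAnd :: map (fun f => bit (ceval v' f)) fs.
Proof. by case=> // fs _; exists fs. Qed.

Lemma chk_sound w : at_tag w -> chk n m v w != [::] -> described w (chk n m v w).
Proof.
(* The induction is on the length because a tag is treated together with the numbers after it: the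
   hypothesis is used at the next tag. *)
have [N] := ubnP (size w); elim: N w => // N IH [|a u] /= ltN tw.
  by move=> _; apply: (DescribedF [::]).
have IHu u' : size u' <= size u -> at_tag u' -> chk n m v u' != [::] ->
    described u' (chk n m v u').
  by move=> le; apply: IH; lia.
rewrite chk_cons; case: ifP => // ok.
case: a tw ok => //= _ ok.
- case/and4P: ok => [/isnumP[q E _] ok1 ok2 tg].
  have [a E1 _] := isnumP ok1; have [q' E2 _] := isnumP ok2.
  set w3 := aft (aft (aft u)) in E2 tg.
  have Eu : u = encode_nat q ++ encode_nat a ++ encode_nat q' ++ w3.
    by rewrite {1}E {1}E1 {1}E2.
  have Ec : chk n m v u = chk n m v w3 by rewrite Eu !chk_nat.
  case: ifP => // fi _; rewrite Ec in fi.
  have Hn : chk n m v w3 != [::] by case: (chk n m v w3) fi.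
  have [|rs [qs [f [sat Ew]]]] := described_fin (IHu w3 _ tg Hn) fi.
    by rewrite Eu !size_cat; lia.
  have -> : TBroadcast :: u = rls ((q, Broadcast a, q') :: rs) ++ inits qs ++ encode_constraint f.
    by rewrite Eu /= -!catA -Ew.
  exact: DescribedR.
- case/and4P: ok => [/isnumP[q E _] ok1 ok2 tg].
  have [a E1 _] := isnumP ok1; have [q' E2 _] := isnumP ok2.
  set w3 := aft (aft (aft u)) in E2 tg.
  have Eu : u = encode_nat q ++ encode_nat a ++ encode_nat q' ++ w3.
    by rewrite {1}E {1}E1 {1}E2.
  have Ec : chk n m v u = chk n m v w3 by rewrite Eu !chk_nat.
  case: ifP => // fi _; rewrite Ec in fi.
  have Hn : chk n m v w3 != [::] by case: (chk n m v w3) fi.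
  have [|rs [qs [f [sat Ew]]]] := described_fin (IHu w3 _ tg Hn) fi.
    by rewrite Eu !size_cat; lia.
  have -> : TReceive :: u = rls ((q, Receive a, q') :: rs) ++ inits qs ++ encode_constraint f.
    by rewrite Eu /= -!catA -Ew.
  exact: DescribedR.
- case/and3P: ok => [/isnumP[q E _] ok2 tg]; have [q' E2 _] := isnumP ok2.
  set w3 := aft (aft u) in E2 tg.
  have Eu : u = encode_nat q ++ encode_nat q' ++ w3 by rewrite {1}E {1}E2.
  have Ec : chk n m v u = chk n m v w3 by rewrite Eu !chk_nat.
  case: ifP => // fi _; rewrite Ec in fi.
  have Hn : chk n m v w3 != [::] by case: (chk n m v w3) fi.
  have [|rs [qs [f [sat Ew]]]] := described_fin (IHu w3 _ tg Hn) fi.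
    by rewrite Eu !size_cat; lia.
  have -> : TInternal :: u = rls ((q, Internal, q') :: rs) ++ inits qs ++ encode_constraint f.
    by rewrite Eu /= -!catA -Ew.
  exact: DescribedR.
- case/andP: ok => [/isnumP[q E _] tg]; set w1 := aft u in E tg.
  have Ec : chk n m v u = chk n m v w1 by rewrite E !chk_nat.
  case: ifP => // fi _; rewrite Ec in fi.
  have Hn : chk n m v w1 != [::] by case: (chk n m v w1) fi.
  have [|qs [f [sat Ew]]] := described_initial (IHu w1 _ tg Hn) fi.
    by rewrite E size_cat; lia.
  have -> : TInitial :: u = inits (q :: qs) ++ encode_constraint f.
    by rewrite E /= -!catA -Ew.
  exact: DescribedI.
- case/andP: ok => [/isnumP[q E Eq] tg]; set w1 := aft u in E tg.
  have Ec : chk n m v u = chk n m v w1 by rewrite E !chk_nat.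
  case: ifP => // fi _; rewrite Ec in fi *.
  have Hn : chk n m v w1 != [::] by case: (chk n m v w1) fi.
  have [|fs Ew Ea] := described_formulas (IHu w1 _ tg Hn) fi.
    by rewrite E size_cat; lia.
  rewrite Ea Eq /= E Ew.
  have -> : TAtLeastOne :: encode_nat q ++ flatten (map (@encode_constraint n) fs) =
    flatten (map (@encode_constraint n) (AtLeastOne q :: fs)) by [].
  exact: (DescribedF (AtLeastOne q :: fs)).
- case/andP: ok => [/isnumP[q E Eq] tg]; set w1 := aft u in E tg.
  have Ec : chk n m v u = chk n m v w1 by rewrite E !chk_nat.
  case: ifP => // fi _; rewrite Ec in fi *.
  have Hn : chk n m v w1 != [::] by case: (chk n m v w1) fi.
  have [|fs Ew Ea] := described_formulas (IHu w1 _ tg Hn) fi.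
    by rewrite E size_cat; lia.
  rewrite Ea Eq /= E Ew.
  have -> : TZero :: encode_nat q ++ flatten (map (@encode_constraint n) fs) =
    flatten (map (@encode_constraint n) (Zero q :: fs)) by [].
  exact: (DescribedF (Zero q :: fs)).
- case: ifP => // /andP[fi sz] _.
  have Hn : chk n m v u != [::] by case: (chk n m v u) fi.
  have [fs Ew Ea] := described_formulas (IHu u (leqnn _) ok Hn) fi.
  move: sz; rewrite Ea; case: fs Ew {Ea} => // f fs -> _ /=; rewrite bit_eq.
  exact: (DescribedF (Not f :: fs)).
- case: ifP => // /andP[fi sz] _.
  have Hn : chk n m v u != [::] by case: (chk n m v u) fi.
  have [fs Ew Ea] := described_formulas (IHu u (leqnn _) ok Hn) fi.
  move: sz; rewrite Ea; case: fs Ew {Ea} => // f [|f' fs] -> // _ /=; rewrite !bit_eq catA.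
  exact: (DescribedF (And f f' :: fs)).
- case: ifP => // /andP[fi sz] _.
  have Hn : chk n m v u != [::] by case: (chk n m v u) fi.
  have [fs Ew Ea] := described_formulas (IHu u (leqnn _) ok Hn) fi.
  move: sz; rewrite Ea; case: fs Ew {Ea} => // f [|f' fs] -> // _ /=; rewrite !bit_eq catA.
  exact: (DescribedF (Or f f' :: fs)).
Qed.

End WellFormedness.

Lemma wfxP x y :
  reflect (exists2 I, x = encode_instance I &
    ceval (fun q : 'I_(nstates I) => fact (teqb TAtLeastOne) y q) (inst_constraint I)) (wfx x y).
Proof.
apply: (iffP and4P) => [[/isdelimP E1 /isdelimP E2 tg fi]|[[n m rs qs f] -> /= sat]].
  set c := chk _ _ _ _ in fi.
  have cn : c != [::] by case: (c) fi.
  have [rs [qs [f [sat E]]]] := described_fin (chk_sound tg cn) fi.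
  exists (Instance rs qs f) => //.
  by rewrite {1}E1 {1}E2 E.
rewrite /encode_instance /= cnt_encode !aft_encode cnt_encode.
split; try exact: isdelim_encode.
- exact: at_tag_rules.
- exact: chk_complete.
Qed.

Fixpoint decode (tg : pred token) (w : seq token) : seq nat :=
  if w is a :: v then if tg a then cnt v :: decode tg v else decode tg v else [::].

Lemma factE tg w k : fact tg w k = (k \in decode tg w).
Proof.
rewrite /fact; elim: w => //= a v ->; case: (tg a) => //=.
by rewrite inE eq_sym.
Qed.

Lemma scan_nat phi k w : (forall u, phi TOne u = false) -> (forall u, phi TEnd u = false) ->
  scan phi (encode_nat k ++ w) = scan phi w.
Proof. by move=> H1 H2; elim: k => /= [|k IH]; rewrite ?H1 ?H2. Qed.

Lemma scan_constraint phi n (f : constraint 'I_n) w :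
  (forall t u, ~~ (t \in [:: TBroadcast; TReceive; TInternal; TInitial]) -> phi t u = false) ->
  scan phi (encode_constraint f ++ w) = scan phi w.
Proof.
move=> H; have Ho u : phi TOne u = false by apply: H; rewrite !inE; do !case: eqP.
have He u : phi TEnd u = false by apply: H; rewrite !inE; do !case: eqP.
elim: f w => [q|q|f IH|f1 IH1 f2 IH2|f1 IH1 f2 IH2] w /=.
all: rewrite H /=; last by rewrite !inE; do !case: eqP.
all: by rewrite -?catA ?scan_nat // ?IH ?IH1 ?IH2.
Qed.

(** * Correctness of the certificates *)

Section Facts.
Variable I : instance.
Local Notation n := (nstates I).
Local Notation m := (nmessages I).
Local Notation x := (encode_instance I).
Local Notation P := (inst_process I).

(** Constraints have tags of their own, so a scan that ignores these and the digits sees only the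
    rules and the initial states. *)
Lemma scan_instance phi (psi : pred (rule 'I_n 'I_m)) (chi : pred 'I_n) :
  (forall t u, ~~ (t \in [:: TBroadcast; TReceive; TInternal; TInitial]) -> phi t u = false) ->
  (forall r u, scan phi (encode_rule r ++ u) = psi r || scan phi u) ->
  (forall q u, scan phi (encode_initial q ++ u) = chi q || scan phi u) ->
  scan phi x = has psi (rule_list I) || has chi (initial_list I).
Proof.
move=> H Hr Hi; have Ho u : phi TOne u = false by apply: H; rewrite !inE; do !case: eqP.
have He u : phi TEnd u = false by apply: H; rewrite !inE; do !case: eqP.
rewrite /encode_instance !scan_nat //.
have -> w : scan phi (flatten (map (@encode_rule n m) (rule_list I)) ++ w) =
    has psi (rule_list I) || scan phi w.
  by elim: (rule_list I) => //= r rs IH; rewrite -catA Hr IH orbA.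
have -> w : scan phi (flatten (map (@encode_initial n) (initial_list I)) ++ w) =
    has chi (initial_list I) || scan phi w.
  elim: (initial_list I) => // q qs IH.
  have -> : flatten (map (@encode_initial n) (q :: qs)) =
      encode_initial q ++ flatten (map (@encode_initial n) qs) by [].
  by rewrite -catA Hi IH orbA.
by rewrite -[encode_constraint _]cats0 scan_constraint //= orbF.
Qed.

Definition ords (s : seq nat) : seq 'I_n := pmap insub s.

Lemma mem_ords (s : seq nat) (q : 'I_n) : (q \in ords s) = (val q \in s).
Proof. by rewrite /ords mem_pmap_sub. Qed.

Lemma fact_initial k : fact (teqb TInitial) x k = has (fun q : 'I_n => val q == k) (initial_list I).
Proof.
rewrite /fact (@scan_instance _ pred0 (fun q => val q == k)).
- by rewrite has_pred0.
- by case=> //= u; rewrite ?inE; do !case: eqP.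
- by move=> [[q [a|a|]] q'] u //=; rewrite -!catA !scan_nat.
- by move=> q u /=; rewrite scan_nat // cnt_encode.
Qed.

Section Tagged.
Variables (tg : pred token) (w : seq token).
Let M : pred 'I_n := mem (ords (decode tg w)).

Lemma sbcastE (a : 'I_m) : sbcast x tg w a = bcast P M a.
Proof.
rewrite /sbcast (@scan_instance _ (fun r => let: (s, y, t) := r in [&& y == Broadcast a, M s & M t]) pred0).
- rewrite has_pred0 orbF; apply/hasP/bcastP => [[[[s y] t] r /and3P[/eqP E Ms Mt]]|[s [t [r Ms Mt]]]].
    by exists s, t; split; rewrite // inE -E.
  by exists (s, Broadcast a, t); [rewrite inE in r|rewrite eqxx Ms].
- by case=> //= u; rewrite ?inE; do !case: eqP.
- move=> [[q [b|b|]] q'] u /=; rewrite -?catA ?scan_nat //.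
  by rewrite cnt_encode !aft_encode !cnt_encode !factE /M /= !mem_ords.
- by move=> q u; rewrite /= scan_nat.
Qed.

Lemma sjustP fwd k : reflect (exists2 q : 'I_n, val q = k & justified P M fwd q) (sjust x tg w fwd k).
Proof.
rewrite /sjust (@scan_instance _ (fun r => let: (s, y, t) := r in
   [&& val (if fwd then t else s) == k, M (if fwd then s else t) & triggered P M y]) pred0).
- rewrite has_pred0 orbF; apply: (iffP hasP) => [[[[s y] t] r /and3P[/eqP E Ms Mt]]|[q <- /justifiedP[s [y [t [r E Ms Mt]]]]]].
    exists (if fwd then t else s) => //.
    by apply/justifiedP; exists s, y, t; split; rewrite // inE.
  by exists (s, y, t); [rewrite inE in r|rewrite E eqxx Ms].
- by case=> //= u; rewrite ?inE; do !case: eqP.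
- move=> [[q [b|b|]] q'] u /=; rewrite -?catA ?scan_nat // ?aft_encode ?cnt_encode ?factE ?sbcastE;
    by rewrite /M /= ?mem_ords; case: (fwd); rewrite ?andbT ?andbA.
- by move=> q u; rewrite /= scan_nat.
Qed.

End Tagged.

Lemma justified_mono (M M' : pred 'I_n) fwd q : (forall p, M p -> M' p) ->
  justified P M fwd q -> justified P M' fwd q.
Proof.
move=> MM' /justifiedP[s [y [t [r E Ms Mt]]]]; apply/justifiedP; exists s, y, t; split=> //.
  exact: MM'.
case: y r Mt => //= a _ /bcastP[s' [t' [r' Ms' Mt']]]; apply/bcastP.
by exists s', t'; split=> //; apply: MM'.
Qed.

Lemma facts_ok_cons t w y : facts_ok y (t :: w) = okfact y t w && facts_ok y w.
Proof. by rewrite /facts_ok /= negb_or negbK. Qed.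

Lemma check_sound y : facts_ok x y -> facts_total y ->
  ceval (fun q : 'I_n => fact (teqb TAtLeastOne) y q) (inst_constraint I) -> PRP I.
Proof.
move=> ok tot sat.
pose l y := ords (decode (teqb TInitial) y).
pose F y := ords (decode (teqb TAtLeastOne) y).
pose mm y := ords (decode (teqb TInternal) y).
apply: (@certificate_reaches _ _ P _ (l y) (F y) (mm y)); split.
- elim: y ok {tot sat} => //= t w IH; rewrite facts_ok_cons => /andP[ok /IH {IH}].
  case: t ok => //= ok; rewrite /l /=; case/orP: ok => [|/sjustP[q Eq J]].
    rewrite fact_initial => /hasP[q qi /eqP <-]; rewrite /ords /= valK /= => ->.
    by rewrite inE qi.
  by rewrite -Eq /ords /= valK /= J orbT.
- move=> q; rewrite mem_cat !mem_ords => /orP qy; rewrite ?mem_ords.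
  elim: y ok {tot sat} qy => [|t w IH] /=; first by move=> _ [].
  rewrite facts_ok_cons => /andP[ok /IH {IH}].
  case: t ok => //= ok IH.
  + case=> [H|/predU1P[->|H]]; [by apply: IH; left| |by apply: IH; right].
    by case/andP: ok; rewrite factE.
  + by rewrite inE => /IH ->; rewrite orbT.
  + case=> [/predU1P[->|H]|H]; [|by apply: IH; left|by apply: IH; right].
    by rewrite -factE.
- move=> q; rewrite mem_cat /l !mem_ords.
  have : forall k, k \in decode (teqb TInitial) y -> k \in decode elim_tag y.
    move: tot; rewrite /facts_total; move: {1 4}y => y0; elim: (y) => //= t w IH.
    rewrite negb_or negb_and negbK => /andP[okt /IH {IH}].
    case: t okt => //= okt IH k; rewrite inE => /predU1P[->|/IH //].
    by rewrite -factE.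
  move=> H /H {H}; elim: (y) => //= t w IH.
  case: t => //=; rewrite !inE => /predU1P[->|/IH]; rewrite ?eqxx ?orbT //.
    by case/orP=> ->; rewrite ?orbT.
  by case/orP=> ->; rewrite ?orbT.
(* An elimination is checked against the final states to its right only; by [justified_mono] these
   may be enlarged to all of [F y]. *)
- suff H y0 : facts_ok x y0 -> {subset F y0 <= F y} ->
     good (fun w q => justified P (mem (w ++ F y)) false q) (mm y0) by apply: H.
  elim: y0 {ok} => //= t w IH; rewrite facts_ok_cons => /andP[okt ok] sub.
  have {}IH : good (fun w q => justified P (mem (w ++ F y)) false q) (mm w).
    apply: IH => // q; rewrite /F mem_ords => qw; apply: sub; rewrite /F mem_ords /=.
    by case: (t) => //=; rewrite inE qw orbT.
  case: t okt sub => //= /andP[_ /sjustP[q Eq J]] sub.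
  rewrite /mm /= -Eq /ords /= valK /= IH andbT.
  apply: (justified_mono _ J) => p pw0.
  have {pw0}pw : val p \in decode elim_tag w by rewrite -mem_ords.
  have : (val p \in decode (teqb TInternal) w) || (val p \in decode (teqb TAtLeastOne) w).
    elim: (w) pw => //= t' w' IHw.
    by case: t' => //=; rewrite !inE => /predU1P[->|/IHw /orP[]->]; rewrite ?eqxx ?orbT.
  rewrite /= mem_cat -!mem_ords => /orP[->//|pF]; apply/orP; right; exact: sub.
- rewrite (eq_ceval _ (_ : _ =1 (fun q : 'I_n => fact (teqb TAtLeastOne) y q))) // => q.
  by rewrite /= mem_ords factE.
Qed.

Definition encode_facts (t : token) (qs : seq 'I_n) : seq token :=
  flatten [seq t :: encode_nat q | q : 'I_n <- qs].

Lemma decode_nat tg k w : tg TOne = false -> tg TEnd = false ->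
  decode tg (encode_nat k ++ w) = decode tg w.
Proof. by move=> H1 H2; elim: k => /= [|k IH]; rewrite ?H1 ?H2. Qed.

Lemma decode_facts tg t qs w : tg TOne = false -> tg TEnd = false ->
  decode tg (encode_facts t qs ++ w) = (if tg t then map val qs else [::]) ++ decode tg w.
Proof.
move=> H1 H2; rewrite /encode_facts.
elim: qs => [|q qs IH] /=; first by case: (tg t).
rewrite -catA decode_nat // cnt_encode IH.
by case: (tg t).
Qed.

Lemma facts_ok_nat y k w : facts_ok y (encode_nat k ++ w) = facts_ok y w.
Proof. by elim: k => [|k IH]; rewrite /= facts_ok_cons. Qed.

Lemma size_encode_facts t qs : uniq qs -> size (encode_facts t qs) <= n * n.+2.
Proof.
move=> U; have le : size qs <= n.
  by have := max_card (mem qs); rewrite card_ord (card_uniqP U).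
apply: leq_trans (_ : size qs * n.+2 <= _); last by rewrite leq_mul2r le orbT.
rewrite /encode_facts; elim: qs {U le} => //= q qs IH.
rewrite size_cat size_rcons size_nseq mulSn.
have := ltn_ord q; lia.
Qed.

Lemma facts_totalE y :
  facts_total y = all (fun k => k \in decode elim_tag y) (decode (teqb TInitial) y).
Proof.
rewrite /facts_total; move: {1 3}y => y0; elim: (y) => //= t w IH.
by rewrite negb_or negb_and negbK IH; case: t => //=; rewrite factE.
Qed.

Lemma facts_ok_encode t qs w :
  (forall (q : 'I_n) qs', suffix (q :: qs') qs -> okfact x t (encode_nat q ++ encode_facts t qs' ++ w)) ->
  facts_ok x w -> facts_ok x (encode_facts t qs ++ w).
Proof.
move=> H ok; elim: qs H => //= q qs IH H.
rewrite /encode_facts /= -catA facts_ok_cons facts_ok_nat -/(encode_facts t qs) IH ?andbT.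
  by apply: H; apply: suffix_refl.
by move=> q' qs' sf; apply: H; apply: suffix_trans sf (suffix_suffix [:: q] qs).
Qed.

Lemma good_suffix (J : seq 'I_n -> 'I_n -> bool) l q w :
  good J l -> suffix (q :: w) l -> J w q.
Proof.
move=> g /suffixP[s E]; rewrite {l}E in g.
by elim: s g => [/andP[]//|a s IH /andP[_ /IH]].
Qed.

Lemma mem_suffix_head (q : 'I_n) w l : suffix (q :: w) l -> q \in l.
Proof. by case/suffixP => s ->; rewrite mem_cat mem_head orbT. Qed.

Lemma check_complete : PRP I ->
  exists2 y, size y <= 3 * (size x * (size x).+2) & check x y.
Proof.
move=> /reaches_certificate[l [F [mm [Ul UF Um [gl sub1 sub2 gm sat]]]]].
(* Facts are justified by facts to their right, so the run is written last and the eliminations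
   first. *)
pose yA := encode_facts TInitial l; pose yF := encode_facts TAtLeastOne F ++ yA.
pose y := encode_facts TInternal mm ++ yF.
have memv (p : 'I_n) (s : seq 'I_n) : (val p \in map val s) = (p \in s).
  by rewrite mem_map //; apply: val_inj.
have dA tg : tg TOne = false -> tg TEnd = false ->
    decode tg yA = if tg TInitial then map val l else [::].
  by move=> H1 H2; rewrite -[yA]cats0 decode_facts ?cats0.
have dF tg : tg TOne = false -> tg TEnd = false ->
    decode tg yF = (if tg TAtLeastOne then map val F else [::]) ++
                   (if tg TInitial then map val l else [::]).
  by move=> H1 H2; rewrite decode_facts ?dA.
have dy tg : tg TOne = false -> tg TEnd = false ->
    decode tg y = (if tg TInternal then map val mm else [::]) ++
      (if tg TAtLeastOne then map val F else [::]) ++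
      (if tg TInitial then map val l else [::]).
  by move=> H1 H2; rewrite decode_facts ?dF.
exists y.
  (* The number of states is written in unary at the front of [x]. The factor 3 counts the lists of
     facts, each of size at most [n * n.+2]. *)
  have le : n <= size x by rewrite /encode_instance size_cat size_rcons size_nseq; lia.
  have -> : size y = size (encode_facts TInternal mm) +
      (size (encode_facts TAtLeastOne F) + size yA) by rewrite /y /yF !size_cat.
  have := size_encode_facts TInitial Ul.
  have := size_encode_facts TAtLeastOne UF; have := size_encode_facts TInternal Um.
  rewrite -/yA; have : n * n.+2 <= size x * (size x).+2 by apply: leq_mul.
  move: (size x * _) (n * _) => K1 K2; lia.
apply/and3P; split.
- apply/wfxP; exists I => //.
  rewrite (eq_ceval _ (_ : _ =1 mem F)) // => q.
  by rewrite factE dy //= cats0 memv.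
- apply: facts_ok_encode; last apply: facts_ok_encode.
  + move=> q w sf; have /= := good_suffix gm sf => J; rewrite cnt_encode; apply/andP; split.
      rewrite factE decode_nat // decode_facts //= dF //= memv; apply: sub1.
      by rewrite mem_cat (mem_suffix_head sf) orbT.
    apply/sjustP; exists q => //; apply: (justified_mono _ J) => p pw.
    have : p \in ords (decode elim_tag (encode_nat q ++ encode_facts TInternal w ++ yF)).
      by rewrite mem_ords decode_nat // decode_facts //= dF //= cats0 -map_cat memv.
    by [].
  + move=> q w sf; rewrite /= cnt_encode factE decode_nat // decode_facts //= dA //= memv.
    by apply: sub1; rewrite mem_cat (mem_suffix_head sf).
  + rewrite -[yA]cats0; apply: facts_ok_encode => // q w sf.
    have /= := good_suffix gl sf => J; rewrite cnt_encode.
    case/orP: J => [qi|J]; apply/orP; [left|right].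
      rewrite fact_initial; apply/hasP; exists q => //.
      by rewrite inE in qi.
    apply/sjustP; exists q => //; apply: (justified_mono _ J) => p pw.
    have : p \in ords (decode (teqb TInitial) (encode_nat q ++ encode_facts TInitial w ++ [::])).
      by rewrite mem_ords decode_nat // decode_facts //= cats0 memv.
    by [].
- rewrite facts_totalE !dy //= cats0; apply/allP => k /mapP[q ql ->].
  by rewrite -map_cat memv sub2.
Qed.

End Facts.

Lemma checkP x : encoded encode_instance PRP x <->
  exists2 y, size y <= 3 * (size x * (size x).+2) & check x y.
Proof.
split=> [[I -> /check_complete //]|[y _ /and3P[/wfxP[I -> sat] ok tot]]].
by exists I => //; apply: check_sound ok tot sat.
Qed.

(** * The verifier runs in polynomial time *)

Section CheckPolynomial.
Local Notation PTb := (PTb TOne).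
Local Notation PTn := (PTn TOne).
Implicit Types (f : (nat -> seq token) -> seq token) (c : (nat -> seq token) -> nat).

Lemma PTn_cnt n f : PT n f -> PTn n (fun e => cnt (f e)).
Proof.
move=> Pf.
apply: (@PT_eq _ n (fun e => para (fun a w acc => if teqb a TOne then TOne :: acc else [::]) [::] (f e))).
  by move=> e; rewrite /cnt; elim: (f e) => //= a w ->; case: teqb.
apply: (PT_para_add (St := fun a w acc e => if teqb a TOne then TOne :: acc else [::]) (u := fun=> 1)) => //.
- exact: PT_nil.
- by move=> a; case: teqb; [apply: PT_cons; apply: PT_var|apply: PT_nil].
- exact: PB_const.
- by move=> _ a w acc _; case: teqb => //=; rewrite addn1.
Qed.

Lemma PT_aft n f : PT n f -> PT n (fun e => aft (f e)).
Proof. by move=> Pf; apply: PT_behead; apply: (PT_dropn (PTn_cnt Pf)). Qed.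

Lemma PTb_hd n f a : PT n f -> PTb n (fun e => hd (f e) a).
Proof.
move=> Pf; apply: PT_eq (PTb_head TOne (fun o => if o is Some b then teqb b a else false) Pf) => e.
by case: (f e).
Qed.

Lemma weqbE w w' : weqb w w' = (w == w').
Proof.
rewrite /weqb; elim: w w' => [|a w IH] [|b w'] //=; rewrite eqseq_cons IH.
by congr (_ && _); apply/teqbP/eqP.
Qed.

Lemma PTb_weqb n f w : PT n f -> PTb n (fun e => weqb (f e) w).
Proof. by move=> Pf; apply: PT_eq (PTb_eqc TOne w Pf) => e; rewrite weqbE. Qed.

Lemma PTb_isdelim n f : PT n f -> PTb n (fun e => isdelim (f e)).
Proof. by move=> Pf; apply: PTb_hd; apply: (PT_dropn (PTn_cnt Pf)). Qed.

Lemma PTb_isnum n f c : PTn n c -> PT n f -> PTb n (fun e => isnum (c e) (f e)).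
Proof.
by move=> Pc Pf; apply: PTb_and; [apply: PTb_ltn => //; apply: PTn_cnt|apply: PTb_isdelim].
Qed.

Lemma PTb_at_tag n f : PT n f -> PTb n (fun e => at_tag (f e)).
Proof. by move=> Pf; apply: PTb_and; apply: PTb_not; apply: PTb_hd. Qed.

Lemma PTb_fact n tg f c : PT n f -> PTn n c -> PTb n (fun e => fact tg (f e) (c e)).
Proof.
move=> Pf Pc; apply: (PTb_scan (phi := fun a v e => tg a && (cnt v == c e)) Pf) => a.
apply: PTb_and; first exact: PTb_const.
by apply: PTb_eqn; [apply: PTn_cnt; apply: PT_var|exact: PT_weak Pc].
Qed.

Lemma PTb_sbcast n tg f h c : PT n f -> PT n h -> PTn n c ->
  PTb n (fun e => sbcast (f e) tg (h e) (c e)).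
Proof.
move=> Pf Ph Pc; apply: (PTb_scan (phi := fun t v e => teqb t TBroadcast &&
    [&& cnt (aft v) == c e, fact tg (h e) (cnt v) & fact tg (h e) (cnt (aft (aft v)))]) Pf) => a.
have Pv : PT n.+1 (fun e : nat -> seq token => e 0) by apply: PT_var.
apply: PTb_and; first exact: PTb_const.
apply: PTb_and; first by apply: PTb_eqn; [do ?apply: PTn_cnt; do ?apply: PT_aft|exact: PT_weak Pc].
by apply: PTb_and; apply: PTb_fact; (try exact: PT_weak Ph); apply: PTn_cnt; do ?apply: PT_aft.
Qed.

Lemma PTb_sjust n tg fwd f h c : PT n f -> PT n h -> PTn n c ->
  PTb n (fun e => sjust (f e) tg (h e) fwd (c e)).
Proof.
move=> Pf Ph Pc.
pose ok s t (e : nat -> seq token) := ((if fwd then t else s) == c e) && fact tg (h e) (if fwd then s else t).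
have Pv : PT n.+1 (fun e : nat -> seq token => e 0) by apply: PT_var.
have Pok (s t : (nat -> seq token) -> nat) : PTn n.+1 s -> PTn n.+1 t ->
    PTb n.+1 (fun e => ok (s e) (t e) (fun i => e i.+1)).
  move=> Ps Pt; rewrite /ok; case: (fwd); apply: PTb_and;
    by [apply: PTb_eqn => //; exact: PT_weak Pc|apply: PTb_fact => //; exact: PT_weak Ph].
apply: (PTb_scan (phi := fun t v e => match t with
    | TInternal => ok (cnt v) (cnt (aft v)) e
    | TBroadcast => ok (cnt v) (cnt (aft (aft v))) e
    | TReceive => ok (cnt v) (cnt (aft (aft v))) e && sbcast (f e) tg (h e) (cnt (aft v))
    | _ => false
    end) Pf); case; try exact: PTb_const.
- by apply: Pok; apply: PTn_cnt; do ?apply: PT_aft.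
- apply: PTb_and; first by apply: Pok; apply: PTn_cnt; do ?apply: PT_aft.
  by apply: PTb_sbcast; [exact: PT_weak Pf|exact: PT_weak Ph|apply: PTn_cnt; apply: PT_aft].
- by apply: Pok; apply: PTn_cnt; do ?apply: PT_aft.
Qed.

Lemma PTb_facts_ok n f h : PT n f -> PT n h -> PTb n (fun e => facts_ok (f e) (h e)).
Proof.
move=> Pf Ph; apply: PTb_not.
apply: (PTb_scan (phi := fun t w e => ~~ okfact (f e) t w) Ph) => t; apply: PTb_not.
have Pv : PT n.+1 (fun e : nat -> seq token => e 0) by apply: PT_var.
have Pc := PTn_cnt Pv.
case: t; try exact: PTb_const.
- by apply: PTb_and; [exact: PTb_fact|apply: PTb_sjust => //; exact: PT_weak Pf].
- apply: PTb_or; [apply: PTb_fact => //; exact: PT_weak Pf|].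
  by apply: PTb_sjust => //; exact: PT_weak Pf.
- exact: PTb_fact.
Qed.

Lemma PTb_facts_total n f : PT n f -> PTb n (fun e => facts_total (f e)).
Proof.
move=> Pf; apply: PTb_not.
apply: (PTb_scan (phi := fun t w e => teqb t TInitial && ~~ fact elim_tag (f e) (cnt w)) Pf) => t.
apply: PTb_and; first exact: PTb_const.
apply: PTb_not; apply: PTb_fact; first exact: PT_weak Pf.
by apply: PTn_cnt; apply: PT_var.
Qed.

Lemma PTb_okargs n c c' a f : PTn n c -> PTn n c' -> PT n f ->
  PTb n (fun e => okargs (c e) (c' e) a (f e)).
Proof.
move=> Pc Pc' Pf; have A1 := PT_aft Pf; have A2 := PT_aft A1; have A3 := PT_aft A2.
have I1 := PTb_isnum Pc Pf; have I2 := PTb_isnum Pc A1; have I3 := PTb_isnum Pc A2.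
by case: a; first [exact: PTb_const | exact: PTb_at_tag | exact: PTb_and I1 (PTb_at_tag A1)
  | exact: PTb_and I1 (PTb_and I2 (PTb_at_tag A2))
  | exact: PTb_and I1 (PTb_and (PTb_isnum Pc' A1) (PTb_and I3 (PTb_at_tag A3)))].
Qed.

Lemma PTb_fin n f : PT n f -> PTb n (fun e => fin (f e)).
Proof. by move=> Pf; do ?apply: PTb_or; apply: PTb_weqb. Qed.

Lemma PT_bit n (P : (nat -> seq token) -> bool) f :
  PTb n P -> PT n f -> PT n (fun e => bit (P e) :: f e).
Proof.
move=> PP Pf; apply: PT_eq (PT_if PP (PT_cons TOne Pf) (PT_cons TEnd Pf)) => e.
by rewrite /bit; case: (P e).
Qed.

Lemma PT_chk_step n a y w acc : PT n y -> PT n w -> PT n acc ->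
  PT n (fun e => chk_step (fact (teqb TAtLeastOne) (y e)) a (w e) (acc e)).
Proof.
move=> Py Pw Pa; have Pv := PTb_fact (teqb TAtLeastOne) Py (PTn_cnt Pw).
have Pn := @PT_nil token n.
have Ph := PTb_hd TAnd Pa.
have Psz k : PTb n (fun e => k < size (acc e)).
  by apply: PTb_ltn; [exact: PTn_const|exact: PTn_size].
have Pb1 : PTb n (fun e => hd (behead (acc e)) TOne) by apply: PTb_hd; apply: PT_behead.
have Pb2 : PTb n (fun e => hd (behead (behead (acc e))) TOne).
  by apply: PTb_hd; do 2!apply: PT_behead.
case: a; cbn [chk_step] => //.
- by apply: (PT_if (one := TOne)) => //; [apply: PTb_fin|apply: PT_const].
- by apply: (PT_if (one := TOne)) => //; [apply: PTb_fin|apply: PT_const].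
- by apply: (PT_if (one := TOne)) => //; [apply: PTb_fin|apply: PT_const].
- by apply: (PT_if (one := TOne)) => //; [apply: PTb_or; apply: PTb_weqb|apply: PT_const].
- by apply: (PT_if (one := TOne)) => //; apply: PT_cons; apply: PT_bit => //; apply: PT_behead.
- by apply: (PT_if (one := TOne)) => //; apply: PT_cons; apply: PT_bit; [apply: PTb_not|apply: PT_behead].
- apply: (PT_if (one := TOne)) => //; first exact: PTb_and (Psz 1).
  by apply: PT_cons; apply: PT_bit; [apply: PTb_not|do 2!apply: PT_behead].
- apply: (PT_if (one := TOne)) => //; first exact: PTb_and (Psz 2).
  by apply: PT_cons; apply: PT_bit; [apply: PTb_and|do 3!apply: PT_behead].
- apply: (PT_if (one := TOne)) => //; first exact: PTb_and (Psz 2).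
  by apply: PT_cons; apply: PT_bit; [apply: PTb_or|do 3!apply: PT_behead].
Qed.

Lemma size_chk_step v a w acc : size (chk_step v a w acc) <= size acc + 2.
Proof.
case: a => //=; do ?case: ifP => //= _; rewrite ?size_behead; by [|lia|case: fin => /=; lia].
Qed.

Lemma PT_chk n c c' y f : PTn n c -> PTn n c' -> PT n y -> PT n f ->
  PT n (fun e => chk (c e) (c' e) (fact (teqb TAtLeastOne) (y e)) (f e)).
Proof.
move=> Pc Pc' Py Pf.
apply: (PT_para_add (St := fun a w acc e => if okargs (c e) (c' e) a w
   then chk_step (fact (teqb TAtLeastOne) (y e)) a w acc else [::]) (u := fun=> 2)) => //.
- exact: PT_const.
- move=> a; have P0 : PT n.+2 (fun e : nat -> seq token => e 0) by apply: PT_var.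
  have P1 : PT n.+2 (fun e : nat -> seq token => e 1) by apply: PT_var.
  apply: (PT_if (one := TOne)); last exact: PT_nil.
    by apply: PTb_okargs => //; [exact: PT_weak2 Pc|exact: PT_weak2 Pc'].
  by apply: PT_chk_step => //; exact: PT_weak2 Py.
- exact: PB_const.
- by move=> e a w acc _; case: okargs => //; apply: size_chk_step.
Qed.

Lemma PTb_check : PTb 2 (fun e => check (e 0) (e 1)).
Proof.
have P0 : PT 2 (fun e : nat -> seq token => e 0) by apply: PT_var.
have P1 : PT 2 (fun e : nat -> seq token => e 1) by apply: PT_var.
apply: PTb_and; last by apply: PTb_and; [exact: PTb_facts_ok|exact: PTb_facts_total].
apply: PTb_and; first exact: PTb_isdelim.
apply: PTb_and; first by apply: PTb_isdelim; apply: PT_aft.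
apply: PTb_and; first by apply: PTb_at_tag; do ?apply: PT_aft.
by apply: PTb_fin; apply: PT_chk => //; do ?apply: PTn_cnt; do ?apply: PT_aft.
Qed.

End CheckPolynomial.

Lemma PRP_in_NP : in_NP (encoded encode_instance PRP).
Proof.
exists token, (fun x y => check (map id x) (map id y)), (3%:P * ('X * ('X + 2%:P)))%R; split.
  exact: PTb_decidable (fun _ _ => id) (fun _ _ => id) PTb_check.
move=> x; rewrite checkP hornerM hornerC hornerM hornerD hornerX hornerC.
rewrite -[(3 * (size x * (size x + 2)))%R]/(3 * (size x * (size x + 2)))%N addn2.
by split=> -[y sz ok]; exists y; move: ok; rewrite ?map_id.
Qed.

(** * Propositional satisfiability and tableaux *)

Fixpoint cmap (T U : Type) (h : T -> U) (f : constraint T) : constraint U :=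
  match f with
  | AtLeastOne q => AtLeastOne (h q)
  | Zero q => Zero (h q)
  | Not f1 => Not (cmap h f1)
  | And f1 f2 => And (cmap h f1) (cmap h f2)
  | Or f1 f2 => Or (cmap h f1) (cmap h f2)
  end.

Fixpoint call (T : Type) (p : pred T) (f : constraint T) : bool :=
  match f with
  | AtLeastOne q | Zero q => p q
  | Not f1 => call p f1
  | And f1 f2 | Or f1 f2 => call p f1 && call p f2
  end.

(** The number of variables depends on the input, so formulas are built over [nat] and moved to an
    ordinal type only at the end, by [encode_cmap]. *)
Fixpoint enc_nc (f : constraint nat) : seq token :=
  match f with
  | AtLeastOne q => TAtLeastOne :: encode_nat q
  | Zero q => TZero :: encode_nat q
  | Not f1 => TNot :: enc_nc f1
  | And f1 f2 => TAnd :: enc_nc f1 ++ enc_nc f2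
  | Or f1 f2 => TOr :: enc_nc f1 ++ enc_nc f2
  end.

Lemma ceval_cmap (T U : Type) (h : T -> U) v f : ceval v (cmap h f) = ceval (v \o h) f.
Proof. by elim: f => //= [f ->|f1 -> f2 ->|f1 -> f2 ->]. Qed.

Lemma call_cmap (T U : Type) (h : T -> U) p f : call p (cmap h f) = call (p \o h) f.
Proof. by elim: f => //= [f1 -> f2 ->|f1 -> f2 ->]. Qed.

Lemma call_true (T : Type) (p : pred T) f : (forall x, p x) -> call p f.
Proof. by move=> H; elim: f => //= [f1 -> f2 ->|f1 -> f2 ->]. Qed.

Lemma ceval_call (T : Type) (p : pred T) v v' f :
  (forall x, p x -> v x = v' x) -> call p f -> ceval v f = ceval v' f.
Proof.
move=> H; elim: f => /= [q /H ->|q /H ->|f IH /IH ->|f1 IH1 f2 IH2|f1 IH1 f2 IH2] //.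
  by case/andP=> /IH1 -> /IH2 ->.
by case/andP=> /IH1 -> /IH2 ->.
Qed.

Lemma encode_cmap n (f : constraint nat) : call (fun k => k < n.+1) f ->
  encode_constraint (cmap (@inord n) f) = enc_nc f.
Proof.
elim: f => /= [q lt|q lt|f IH /IH -> //|f1 IH1 f2 IH2|f1 IH1 f2 IH2]; rewrite ?inordK //.
  by case/andP=> /IH1 -> /IH2 ->.
by case/andP=> /IH1 -> /IH2 ->.
Qed.

(** States are propositional variables; there are [n.+1] of them so that [inord] applies. The order
    of the initial states is the one in which [natcat] writes them. *)
Definition sat_instance (n : nat) (f : constraint nat) : instance :=
  @Instance n.+1 0 [::] [seq inord i | i <- rev (iota 0 n.+1)] (cmap (@inord n) f).

Lemma encode_initials n m w : m <= n.+1 ->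
  flatten [seq encode_initial q | q <- [seq (inord i : 'I_n.+1) | i <- rev (iota 0 m)]] ++ w =
  natcat (fun i => TInitial :: encode_nat i) m w.
Proof.
elim: m => // m IH lt.
have -> : rev (iota 0 m.+1) = m :: rev (iota 0 m) by rewrite -[m.+1]addn1 iotaD rev_cat.
rewrite [RHS]/= -IH 1?ltnW // !map_cons /encode_initial /= inordK //.
by rewrite -catA.
Qed.

Lemma encode_sat_instance n f : call (fun k => k < n.+1) f ->
  encode_instance (sat_instance n f) =
  encode_nat n.+1 ++ encode_nat 0 ++
  natcat (fun i => TInitial :: encode_nat i) n.+1 (enc_nc f).
Proof.
move=> cf; rewrite /encode_instance [inst_constraint _]/= encode_cmap //.
by rewrite -(encode_initials (n := n)).
Qed.

Lemma sat_instanceP n f : call (fun k => k < n.+1) f ->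
  PRP (sat_instance n f) <-> exists v, ceval v f.
Proof.
move=> cf; rewrite /PRP reaches_cov; split=> [[A _]|[v vf]].
  by rewrite /= ceval_cmap => H; exists (mem A \o (@inord n)).
pose A : {set 'I_n.+1} := [set q : 'I_n.+1 | v q].
exists A; last first.
  rewrite /= ceval_cmap (ceval_call (v' := v) _ cf) // => k lt.
  by rewrite /= inE inordK.
(* One node for each true variable, labelled by it; the run is empty. *)
exists {q : 'I_n.+1 | q \in A}, val, val; split=> [q||].
- rewrite inE /=; apply/mapP; exists (val (val q)); last by rewrite inord_val.
  by rewrite mem_rev -[0 :: _]/(iota 0 n.+1) mem_iota ltn_ord.
- exact: rt_refl.
- apply/setP => q; apply/idP/labelsP => [qA|[u <-]]; last exact: valP.
  by exists (exist _ q qA).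
Qed.

Fixpoint conjn (T : Type) (f : nat -> constraint T) (n : nat) (b : constraint T) : constraint T :=
  if n is k.+1 then And (f k) (conjn f k b) else b.

Lemma conjnP T (v : T -> bool) f n b :
  reflect ((forall i, i < n -> ceval v (f i)) /\ ceval v b) (ceval v (conjn f n b)).
Proof.
elim: n => [|n IH] /=; first by apply: (iffP idP) => [//|[]].
apply: (iffP andP) => [[fn /IH[H vb]]|[H vb]]; split=> //.
- by move=> i; rewrite ltnS leq_eqVlt => /predU1P[->|/H].
- exact: H.
- by apply/IH; split=> // i lt; apply: H; apply: ltnW.
Qed.

Lemma call_conjn T (p : pred T) f n b :
  (forall i, i < n -> call p (f i)) -> call p b -> call p (conjn f n b).
Proof.
move=> H pb; elim: n H => //= n IH H; rewrite H //= IH // => i lt.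
by apply: H; apply: ltnW.
Qed.

Lemma enc_conjn f n b : enc_nc (conjn f n b) = natcat (fun i => TAnd :: enc_nc (f i)) n (enc_nc b).
Proof. by elim: n => //= n ->. Qed.

(** * Relations between cells as propositional formulas *)

Section Templates.
Variables (Gam : finType) (gam0 : Gam).
Local Notation g := #|Gam|.
Implicit Type (R : seq Gam -> bool).

(** The syntax has no constants, so truth is an excluded middle on an arbitrary atom. *)
Definition ctrue : constraint (nat * Gam) := Or (AtLeastOne (0, gam0)) (Zero (0, gam0)).
Definition cand : seq (constraint (nat * Gam)) -> constraint (nat * Gam) :=
  foldr (@And _) ctrue.
Definition cor : seq (constraint (nat * Gam)) -> constraint (nat * Gam) :=
  foldr (@Or _) (Not ctrue).

Lemma ceval_cand v fs : ceval v (cand fs) = all (ceval v) fs.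
Proof. by elim: fs => /= [|f fs ->] //; rewrite orbN. Qed.

Lemma ceval_cor v fs : ceval v (cor fs) = has (ceval v) fs.
Proof. by elim: fs => /= [|f fs ->] //; rewrite orbN. Qed.

Definition isf (i : nat) (y : Gam) : constraint (nat * Gam) :=
  cand [seq if z == y then AtLeastOne (i, z) else Zero (i, z) | z <- enum Gam].

Lemma ceval_isf v i y : ceval v (isf i y) = [forall z, v (i, z) == (z == y)].
Proof.
rewrite ceval_cand all_map; apply/allP/forallP => H z; last first.
  by move=> _ /=; have := H z; case: (z =P y) => _ /=; case: (v (i, z)).
have := H z (mem_enum _ z); rewrite /=.
by case: (z =P y) => _ /=; case: (v (i, z)).
Qed.

(** The truth table of [R], as a disjunction over the tuples that satisfy it. Its size is constant,
    because [k] and [Gam] do not depend on the input. *)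
Definition relf (k : nat) R : constraint (nat * Gam) :=
  cor [seq cand [seq isf i (nth gam0 s i) | i <- iota 0 k] | s : k.-tuple Gam <- enum {: k.-tuple Gam} & R s].

Lemma relfP v k R :
  reflect (exists s : k.-tuple Gam, R s /\ forall i, i < k -> forall z, v (i, z) = (z == nth gam0 s i))
    (ceval v (relf k R)).
Proof.
rewrite ceval_cor has_map; apply: (iffP hasP) => [[s]|[s [Rs H]]].
  rewrite mem_filter => /andP[Rs _]; rewrite /= ceval_cand all_map => /allP H.
  exists s; split=> // i lt z.
  have := H i; rewrite mem_iota => /(_ lt); rewrite /= ceval_isf => /forallP /(_ z) /eqP ->.
  by [].
exists s; first by rewrite mem_filter Rs mem_enum.
rewrite /= ceval_cand all_map; apply/allP => i; rewrite mem_iota => /H {}H.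
by rewrite /= ceval_isf; apply/forallP => z; rewrite H.
Qed.

(* Variable [c * g + enum_rank y] says that cell [c] contains [y]. *)
Definition cells (cs : seq nat) (p : nat * Gam) : nat := nth 0 cs p.1 * g + enum_rank p.2.

Definition tmpl (cs : seq nat) (k : nat) R : constraint nat := cmap (cells cs) (relf k R).

Definition content (v : nat -> bool) (c : nat) : Gam :=
  odflt gam0 [pick y | [forall z, v (c * g + enum_rank z) == (z == y)]].

(** Every disjunct of [relf] fixes all variables of its cells, so a satisfied template already
    implies that they hold exactly one letter; no separate clause says so, and the default in
    [content] is not reached here. *)
Lemma tmpl_sound v cs R : ceval v (tmpl cs (size cs) R) -> R (map (content v) cs).
Proof.
rewrite ceval_cmap => /relfP[s [Rs H]]; suff -> : map (content v) cs = s by [].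
apply: (@eq_from_nth _ gam0); first by rewrite size_map size_tuple.
move=> i; rewrite size_map => lt; rewrite (nth_map 0) // /content.
case: pickP => [y /forallP Hy|/(_ (nth gam0 s i))/negbT/forallPn[z /eqP[]]] /=.
  have /eqP := Hy y; rewrite eqxx (H i lt y : v (nth 0 cs i * g + enum_rank y) = _).
  by move/eqP.
exact: (H i lt z).
Qed.

Definition assignment (w : nat -> Gam) (k : nat) : bool :=
  enum_rank (w (k %/ g)) == k %% g :> nat.

Lemma tmpl_complete w cs R : R (map w cs) -> ceval (assignment w) (tmpl cs (size cs) R).
Proof.
move=> Rw; rewrite ceval_cmap; apply/relfP; exists (map_tuple w (in_tuple cs)); split=> // i lt z.
have g0 : 0 < g by apply/card_gt0P; exists gam0.
rewrite /= (nth_map 0) // /assignment /cells /= divnMDl // modnMDl divn_small ?modn_small ?ltn_ord //.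
by rewrite addn0 eq_sym; apply/eqP/eqP => [/val_inj/enum_rank_inj|->].
Qed.

Lemma call_tmpl cs k R N : 0 < N -> all (fun c => c < N) cs ->
  call (fun x => x < N * g) (tmpl cs k R).
Proof.
move=> N0 /allP H; rewrite call_cmap; apply: call_true => -[i z] /=; rewrite /cells /=.
have : nth 0 cs i < N.
  by have [lt|le] := ltnP i (size cs); [apply: H; apply: mem_nth|rewrite nth_default].
move=> lt; apply: leq_trans (_ : (nth 0 cs i).+1 * g <= _); last by rewrite leq_mul2r lt orbT.
by rewrite mulSn addnC ltn_add2r ltn_ord.
Qed.

End Templates.

(** * Tableaux of multi-tape machines *)

Section Tableau.
Variables (k : nat) (G : finType) (M : machine k.+2 G).

(* Position 0 of a row holds the state and the letters under the heads;
   position [j.+1] holds, for each tape, the letters at distance [j.+1] on the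
   left and on the right of the head. *)
Definition tile : finType :=
  ((tm_state M * {ffun 'I_k.+2 -> option G}) +
   {ffun 'I_k.+2 -> option G * option G})%type.

Definition side (left : bool) (c : tile) (i : 'I_k.+2) : option G :=
  if c is inr f then (if left then (f i).1 else (f i).2) else None.

Definition next0 (c0 c1 : tile) : tile :=
  match c0 with
  | inl (q, h) =>
      if tm_delta q h is Some (q', a) then
        inl (q', [ffun i => match (a i).2 with
                            | MoveLeft => side true c1 i
                            | MoveRight => side false c1 i
                            | Stay => (a i).1
                            end])
      else c0
  | inr _ => c0
  end.

(** Seen from the head, a move shifts the two halves of a tape in opposite directions, one taking
    its letter from [cl] and the other from [cr]. If [cl] is the cell under the heads, the letter
    shifted in is the one just written. *)
Definition nextc (c0 cl c cr : tile) : tile :=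
  match c0 with
  | inl (q, h) =>
      if tm_delta q h is Some (q', a) then
        inr [ffun i => match (a i).2 with
             | MoveLeft => (side true cr i, if cl is inl _ then (a i).1 else side false cl i)
             | MoveRight => (if cl is inl _ then (a i).1 else side true cl i, side false cr i)
             | Stay => (side true c i, side false c i)
             end]
      else c
  | inr _ => c
  end.

Definition tm_row (c : tm_config M) (j : nat) : tile :=
  if j is j'.+1 then inr [ffun i => (nth None (c.2 i).1 j', nth None (c.2 i).2 j'.+1)]
  else inl (c.1, [ffun i => tape_read (c.2 i)]).

Definition next_row (r : nat -> tile) (j : nat) : tile :=
  if j is j'.+1 then nextc (r 0) (r j') (r j) (r j.+1) else next0 (r 0) (r 1).

Lemma tm_row_step c : tm_row (tm_step c) = next_row (tm_row c).
Proof.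
apply: functional_extensionality => j; rewrite /tm_step /tm_action.
case E: (tm_delta c.1 _) => [[q a]|]; last by case: j => [|j] /=; rewrite E.
case: j => [|j] /=; rewrite E.
  congr (inl (_, _)); apply/ffunP => i; rewrite !ffunE /tape_read /=.
  by case: (a i) => s [] //=; rewrite -nth0 ?nth_behead.
congr inr; apply/ffunP => i; rewrite !ffunE /=.
case: (a i) => s [] /=; rewrite !nth_behead //.
- by case: j => [|j] //=; rewrite ffunE ?nth_behead.
- by case: j => [|j] //=; rewrite ffunE.
Qed.

Lemma tm_row_iter t c : tm_row (iter t (@tm_step _ _ M) c) = iter t next_row (tm_row c).
Proof. by elim: t => //= t <-; rewrite tm_row_step. Qed.

(* Wrong contents at the right end move left by at most one cell per step. *)
Lemma tableau_correct T (c : nat -> nat -> tile) (r : nat -> tile) :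
  (forall j, j <= T.+1 -> c 0 j = r j) ->
  (forall t, t < T -> c t.+1 0 = next0 (c t 0) (c t 1)) ->
  (forall t j, t < T -> j < T -> c t.+1 j.+1 = nextc (c t 0) (c t j) (c t j.+1) (c t j.+2)) ->
  c T 0 = iter T next_row r 0.
Proof.
move=> H0 H1 H2; suff H t j : t <= T -> j + t <= T.+1 -> c t j = iter t next_row r j.
  by apply: H; lia.
elim: t j => [|t IH] j lt le; first by apply: H0; lia.
case: j le => [|j] le /=.
  by rewrite H1 // !IH //; lia.
by rewrite H2 ?IH //; lia.
Qed.

Definition init_tile (first : bool) (a b : option G) : tile :=
  let h (i : 'I_k.+2) := match val i with 0 => a | 1 => b | _ => None end in
  if first then inl (tm_start M, [ffun i => h i]) else inr [ffun i => (None, h i)].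

Lemma tm_row_init x y j : tm_row (tm_init M x y) j = init_tile (j == 0) (onth x j) (onth y j).
Proof.
case: j => [|j]; rewrite /tm_row /init_tile /tm_init /=.
  congr (inl (_, _)); apply/ffunP => -[i lt]; rewrite !ffunE /=.
  by case: i lt => [|[|i]] lt //=; [case: x|case: y].
congr inr; apply/ffunP => -[i lt]; rewrite !ffunE /=.
by case: i lt => [|[|i]] lt; rewrite -?onthE nth_nil.
Qed.

Definition cert_letter (c : tile) : option G :=
  match c with inl (_, h) => h (inord 1) | inr f => (f (inord 1)).2 end.

Lemma cert_letter_init first a b : cert_letter (init_tile first a b) = b.
Proof. by case: first => /=; rewrite ffunE /= inordK. Qed.

Definition accepting (c : tile) : bool := if c is inl (q, _) then q \in tm_accept M else false.

End Tableau.

(** Extracts the guessed certificate from row 0: a blank is followed by blanks only, so the letters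
    form a word. *)
Lemma word_of_letters (C : Type) n (f : nat -> option C) :
  (forall j, j.+1 < n -> f j = None -> f j.+1 = None) ->
  exists2 y, size y <= n & forall j, j < n -> onth y j = f j.
Proof.
elim: n f => [|n IH] f H; first by exists [::].
case E: (f 0) => [c|]; last first.
  exists [::] => // j lt; rewrite onth0n; elim: j lt => // j IHj lt.
  by rewrite H // -IHj // ltnW.
have [y sz Hy] := IH (f \o succn) (fun j lt => H j.+1 lt).
by exists (c :: y) => // -[|j] //=; rewrite ltnS => /Hy.
Qed.

Lemma horner_mono (p : {poly nat}) m n : m <= n -> (p.[m]%R <= p.[n]%R)%N.
Proof.
move=> le; elim/poly_ind: p => [|p c IH]; first by rewrite !horner0.
by rewrite !hornerMXaddC leq_add2r leq_mul.
Qed.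

(** * The reduction from an arbitrary verifier *)

Section CookLevin.
Variables (A C G : finType) (k : nat) (iA : A -> G) (iC : C -> G) (M : machine k.+2 G).

Local Notation Gam := (tile M).
Local Notation step := (@tm_step _ _ M).

Let gam0 : Gam := init_tile M true None None.

Definition stepR (s : seq Gam) : bool :=
  nth gam0 s 4 == nextc (nth gam0 s 0) (nth gam0 s 1) (nth gam0 s 2) (nth gam0 s 3).

Definition step0R (s : seq Gam) : bool :=
  nth gam0 s 2 == next0 (nth gam0 s 0) (nth gam0 s 1).

(** The input letter [a] is prescribed, while the certificate letter [b] is guessed: it must be
    absent beyond the size bound, and its absence forces that of the next one. *)
Definition init_ok (first bnd : bool) (a : option A) (c c' : Gam) (b : option C) : bool :=
  [&& c == init_tile M first (omap iA a) (omap iC b), bnd || (b == None) &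
      (b == None) ==> (cert_letter c' == None)].

Definition initR (first bnd : bool) (a : option A) (s : seq Gam) : bool :=
  [exists b, init_ok first bnd a (nth gam0 s 0) (nth gam0 s 1) b].

Definition accR (s : seq Gam) : bool := accepting (nth gam0 s 0).

(** Rows have positions 0 to [T + 2]: the step formulas read up to [T + 1], and the initial row
    looks one cell further for the next certificate letter. *)
Definition cell (T t j : nat) : nat := t * (T + 3) + j.

Definition step_formula (T t j : nat) : constraint nat :=
  tmpl gam0 [:: cell T t 0; cell T t j; cell T t j.+1; cell T t j.+2; cell T t.+1 j.+1] 5 stepR.

Definition step0_formula (T t : nat) : constraint nat :=
  tmpl gam0 [:: cell T t 0; cell T t 1; cell T t.+1 0] 3 step0R.

Definition init_formula (T j : nat) (first bnd : bool) (a : option A) : constraint nat :=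
  tmpl gam0 [:: cell T 0 j; cell T 0 j.+1] 2 (initR first bnd a).

(* [T] is the number of steps, [B] the maximal size of the certificate, and
   [xl] the letters of the input. *)
Definition formula (T B : nat) (xl : nat -> option A) : constraint nat :=
  conjn (fun t => conjn (step_formula T t) T (step0_formula T t)) T
    (conjn (fun j => init_formula T j (j == 0) (j < B) (xl j)) T.+2
       (tmpl gam0 [:: cell T T 0] 1 accR)).

Lemma formula_sound T B (x : seq A) v : ceval v (formula T B (onth x)) ->
  exists2 y : seq C, size y <= B &
    (iter T step (tm_init M (map iA x) (map iC y))).1 \in tm_accept M.
Proof.
case/conjnP => Hs /conjnP[Hi Hacc].
pose c t j := content gam0 v (cell T t j).
have H1 t : t < T -> c t.+1 0 = next0 (c t 0) (c t 1).
  by case/Hs/conjnP => _ /(tmpl_sound (cs := [:: _; _; _])) /eqP.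
have H2 t j : t < T -> j < T -> c t.+1 j.+1 = nextc (c t 0) (c t j) (c t j.+1) (c t j.+2).
  move=> lt ltj; have /conjnP[/(_ j ltj)] := Hs t lt.
  by move=> /(tmpl_sound (cs := [:: _; _; _; _; _])) /eqP.
pose ok j := init_ok (j == 0) (j < B) (onth x j) (c 0 j) (c 0 j.+1).
(* The certificate letters guessed by the assignment, which [initR] only asserts to exist. *)
pose fy j := odflt None [pick b | ok j b].
have fyP j : j < T.+2 -> ok j (fy j).
  move=> /Hi /(tmpl_sound (cs := [:: _; _])) /existsP[b Hb].
  by rewrite /fy; case: pickP => //= /(_ b); rewrite /ok Hb.
have fyN j : j.+1 < T.+2 -> fy j = None -> fy j.+1 = None.
  move=> lt E; have /and3P[_ _] := fyP j (ltnW lt); rewrite E eqxx /= => /eqP Ec.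
  have /and3P[/eqP E1 _ _] := fyP _ lt; move: Ec; rewrite E1 cert_letter_init.
  by case: (fy j.+1).
have [y sz Hy] := word_of_letters fyN; exists y.
  (* As [y] has at most [T.+2] letters, a letter at position [B] would lie in the part of row 0 that
     the formula constrains. *)
  rewrite leqNgt; apply/negP => lt; have ltB : B < T.+2 by apply: leq_trans sz.
  have /and3P[_] := fyP _ ltB; rewrite ltnn /= => /eqP E _.
  by have := onthTE y B; rewrite Hy // E lt.
have H0 j : j <= T.+1 -> c 0 j = tm_row (tm_init M (map iA x) (map iC y)) j.
  move=> le; have /and3P[/eqP -> _ _] := fyP j le.
  by rewrite tm_row_init !onth_map Hy.
have := tmpl_sound (cs := [:: _]) Hacc; rewrite /accR /= -/(c T 0).
by rewrite (tableau_correct H0 H1 H2) -tm_row_iter.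
Qed.

Lemma formula_complete T B (x : seq A) (y : seq C) : size y <= B ->
  (iter T step (tm_init M (map iA x) (map iC y))).1 \in tm_accept M ->
  exists v, ceval v (formula T B (onth x)).
Proof.
move=> sz acc; set c0 := tm_init _ _ _ in acc.
pose w n := tm_row (iter (n %/ (T + 3)) step c0) (n %% (T + 3)).
have wE t j : j < T + 3 -> w (cell T t j) = tm_row (iter t step c0) j.
  move=> lt; rewrite /w /cell divnMDl ?modnMDl ?divn_small ?modn_small ?addn0 //.
  by rewrite addn3.
have wS t j : tm_row (iter t.+1 step c0) j = next_row (tm_row (iter t step c0)) j.
  by rewrite -tm_row_step.
exists (assignment w); apply/conjnP; split=> [t lt|].
  apply/conjnP; split=> [j ltj|].
    apply: (tmpl_complete gam0 (cs := [:: _; _; _; _; _])).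
    by rewrite /stepR /= !wE ?wS //; lia.
  apply: (tmpl_complete gam0 (cs := [:: _; _; _])).
  by rewrite /step0R /= !wE ?wS //; lia.
apply/conjnP; split=> [j lt|].
  apply: (tmpl_complete gam0 (cs := [:: _; _])); apply/existsP; exists (onth y j).
  rewrite /init_ok /= !wE ?addn3 //; last by apply: ltnW.
  rewrite -[iter 0 step c0]/c0 !tm_row_init !onth_map eqxx cert_letter_init andTb.
  have [lt'|le] := ltnP j (size y); last by rewrite !onth_default ?eqxx ?orbT // leqW.
  have := onthTE y j; rewrite lt'; case: (onth y j) => // b _.
  by rewrite (leq_trans lt' sz).
apply: (tmpl_complete gam0 (cs := [:: _])).
by rewrite /accR /= wE // addn3.
Qed.

Definition nvars (T : nat) : nat := (T.+1 * (T + 3)) * #|Gam|.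

Lemma call_formula T B xl : call (fun x => x < nvars T) (formula T B xl).
Proof.
have N0 : 0 < T.+1 * (T + 3) by rewrite addn3.
have cellP t j : t <= T -> j < T + 3 -> cell T t j < T.+1 * (T + 3).
  move=> lt ltj; rewrite /cell; apply: leq_trans (_ : t.+1 * (T + 3) <= _).
    by rewrite mulSn addnC ltn_add2r.
  by rewrite leq_mul2r ltnS lt orbT.
apply: call_conjn => [t lt|].
  apply: call_conjn => [j ltj|]; apply: call_tmpl => //=; rewrite !cellP //; lia.
apply: call_conjn => [j lt|]; apply: call_tmpl => //=; rewrite !cellP //; lia.
Qed.

Definition output (T B : nat) (xl : nat -> option A) : seq token :=
  encode_nat (nvars T) ++ encode_nat 0 ++
  natcat (fun i => TInitial :: encode_nat i) (nvars T) (enc_nc (formula T B xl)).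

Lemma output_correct T B (x : seq A) :
  encoded encode_instance PRP (output T B (onth x)) <->
  exists2 y : seq C, size y <= B &
    (iter T step (tm_init M (map iA x) (map iC y))).1 \in tm_accept M.
Proof.
have nv : nvars T = (nvars T).-1.+1.
  rewrite prednK // muln_gt0 addn3; apply/card_gt0P; by exists gam0.
have cf := call_formula T B (onth x); rewrite nv in cf.
have E : output T B (onth x) = encode_instance (sat_instance (nvars T).-1 (formula T B (onth x))).
  by rewrite encode_sat_instance // -nv.
rewrite E; split.
  move=> [I /encode_instance_inj <- /(sat_instanceP cf)[v]]; exact: formula_sound.
move=> [y sz acc]; eexists; first by [].
by apply/(sat_instanceP cf); apply: formula_complete acc.
Qed.

(** * The reduction runs in polynomial time *)

Section OutputPolynomial.
Local Notation H := (A + token)%type.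
Local Notation one := (inr TOne : H).
Local Notation PTn := (@PTn H one).
Local Notation env := (nat -> seq H).

(** Input and output are on tapes of the same machine, hence words over the sum of the two
    alphabets. *)
Definition PTo (n : nat) (f : env -> seq token) : Prop :=
  PT n (fun e => map inr (f e) : seq H).

Lemma PTo_cons n a f : PTo n f -> PTo n (fun e => a :: f e).
Proof. exact: PT_cons. Qed.

Lemma PTo_cat n f h : PTo n f -> PTo n h -> PTo n (fun e => f e ++ h e).
Proof. by move=> Pf Ph; apply: PT_eq (PT_cat Pf Ph) => e; rewrite map_cat. Qed.

Lemma PTo_nat n (c : env -> nat) : PTn n c -> PTo n (fun e => encode_nat (c e)).
Proof.
move=> Pc; apply: PT_eq (PT_cat Pc (PT_const n [:: inr TEnd])) => e.
by rewrite map_rcons map_nseq cats1.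
Qed.

Lemma PTo_natcat n (c : env -> nat) (h : nat -> env -> seq token) f :
  PTn n c -> PTo n.+1 (fun e => h (size (e 0)) (fun i => e i.+1)) -> PTo n f ->
  PTo n (fun e => natcat (fun i => h i e) (c e) (f e)).
Proof.
move=> Pc Ph Pf; apply: PT_eq (PT_natcat (h := fun i e => map inr (h i e)) Pc Ph Pf) => e.
by elim: (c e) => //= m ->; rewrite map_cat.
Qed.

Lemma PTo_conjn n (c : env -> nat) (h : nat -> env -> constraint nat) (f : env -> constraint nat) :
  PTn n c -> PTo n.+1 (fun e => enc_nc (h (size (e 0)) (fun i => e i.+1))) ->
  PTo n (fun e => enc_nc (f e)) ->
  PTo n (fun e => enc_nc (conjn (fun i => h i e) (c e) (f e))).
Proof.
move=> Pc Ph Pf.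
have := PTo_natcat (h := fun i e => TAnd :: enc_nc (h i e)) Pc (PTo_cons TAnd Ph) Pf.
by apply: PT_eq => e; rewrite enc_conjn.
Qed.

(** As [R] is fixed, the induction is on the constant formula [relf]; only the cell numbers depend
    on the environment. *)
Lemma PTo_tmpl n (cs : env -> seq nat) m R :
  (forall i, PTn n (fun e => nth 0 (cs e) i)) ->
  PTo n (fun e => enc_nc (tmpl gam0 (cs e) m R)).
Proof.
move=> Pcs; rewrite /tmpl; elim: (relf gam0 m R) => [q|q|f IH|f1 IH1 f2 IH2|f1 IH1 f2 IH2] /=.
- apply: PTo_cons; apply: PTo_nat; apply: PTn_add; last exact: PTn_const.
  by apply: PTn_mul; [exact: Pcs|exact: PTn_const].
- apply: PTo_cons; apply: PTo_nat; apply: PTn_add; last exact: PTn_const.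
  by apply: PTn_mul; [exact: Pcs|exact: PTn_const].
- exact: PTo_cons.
- by apply: PTo_cons; apply: PTo_cat.
- by apply: PTo_cons; apply: PTo_cat.
Qed.

Lemma PTo_head n (X : env -> seq H) (h : option H -> env -> seq token) :
  PT n X -> (forall o, PTo n (h o)) -> PTo n (fun e => h (ohead (X e)) e).
Proof.
move=> PX Ph; apply: PT_eq (PT_case (h := fun a e => map inr (h (Some a) e)) PX (Ph None) (fun a => Ph (Some a))) => e.
by case: (X e).
Qed.

Lemma PTo_bool n (P : env -> bool) (h : bool -> env -> seq token) :
  PTb one n P -> (forall b, PTo n (h b)) -> PTo n (fun e => h (P e) e).
Proof.
by move=> PP Ph; apply: PT_eq (PT_if PP (Ph true) (Ph false)) => e; case: (P e).
Qed.

Definition letter (o : option H) : option A := if o is Some (inl a) then Some a else None.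

Lemma PTn_cell n (T t j : env -> nat) : PTn n T -> PTn n t -> PTn n j ->
  PTn n (fun e => cell (T e) (t e) (j e)).
Proof.
move=> PT' Pt Pj; apply: PTn_add Pj; apply: PTn_mul => //.
by apply: PTn_add => //; apply: PTn_const.
Qed.

Lemma PTo_output (T B : nat -> nat) :
  PTn 1 (fun e => T (size (e 0))) -> PTn 1 (fun e => B (size (e 0))) ->
  PTo 1 (fun e => output (T (size (e 0))) (B (size (e 0))) (fun j => letter (ohead (drop j (e 0))))).
Proof.
move=> PT' PB'.
have PTk n i : i < n -> PTn n (fun e => T (size (e i))).
  by move=> lt; apply: (PT_ren (sg := fun _ => i) _ PT').
have PBk n i : i < n -> PTn n (fun e => B (size (e i))).
  by move=> lt; apply: (PT_ren (sg := fun _ => i) _ PB').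
have Psz n i : i < n -> PTn n (fun e => size (e i)).
  by move=> lt; apply: PTn_size; apply: PT_var.
have Pc0 n m : PTn n (fun=> m) by apply: PTn_const.
have Pnv n i : i < n -> PTn n (fun e => nvars (T (size (e i)))).
  move=> lt; apply: PTn_mul => //; apply: PTn_mul; first by apply: PTn_succ; apply: PTk.
  by apply: PTn_add => //; apply: PTk.
apply: PTo_cat; first by apply: PTo_nat; apply: Pnv.
apply: PTo_cat; first exact: PTo_nat.
apply: (PTo_natcat (h := fun i e => TInitial :: encode_nat i)); first exact: Pnv.
  by apply: PTo_cons; apply: PTo_nat; apply: Psz.
have Pnil n i : PTn n (fun=> nth 0 [::] i) by rewrite nth_nil.
apply: (PTo_conjn (h := fun t e => conjn (step_formula (T (size (e 0))) t) (T (size (e 0)))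
    (step0_formula (T (size (e 0))) t))); first exact: PTk.
  apply: (PTo_conjn (h := fun j e => step_formula (T (size (e 1))) (size (e 0)) j)).
  - exact: PTk.
  - apply: PTo_tmpl => i.
    case: i => [|[|[|[|[|i]]]]]; first [exact: Pnil | apply: PTn_cell; do ?apply: PTn_succ; first [exact: PTk | exact: Psz | exact: Pc0]].
  - apply: PTo_tmpl => i.
    case: i => [|[|[|i]]]; first [exact: Pnil | apply: PTn_cell; do ?apply: PTn_succ; first [exact: PTk | exact: Psz | exact: Pc0]].
apply: (PTo_conjn (h := fun j e => init_formula (T (size (e 0))) j (j == 0)
   (j < B (size (e 0))) (letter (ohead (drop j (e 0)))))).
- by apply: PTn_succ; apply: PTn_succ; apply: PTk.
(* The relation of this template depends on the input letter and on two flags; case analysis makes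
   all three constant before [PTo_tmpl] applies. *)
- apply: (PTo_head (h := fun o e => enc_nc (init_formula (T (size (e 1))) (size (e 0)) (size (e 0) == 0)
     (size (e 0) < B (size (e 1))) (letter o)))).
    by apply: PT_drop; apply: PT_var.
  move=> o; apply: (PTo_bool (h := fun b e => enc_nc (init_formula (T (size (e 1))) (size (e 0)) b
     (size (e 0) < B (size (e 1))) (letter o)))).
    by apply: PTb_eqn; [apply: Psz|].
  move=> b; apply: (PTo_bool (h := fun b' e => enc_nc (init_formula (T (size (e 1))) (size (e 0)) b
     b' (letter o)))).
    by apply: PTb_ltn; [apply: Psz|apply: PBk].
  move=> b'; apply: PTo_tmpl => i.
  case: i => [|[|i]]; first [exact: Pnil | apply: PTn_cell; do ?apply: PTn_succ; first [exact: PTk | exact: Psz | exact: Pc0]].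
- apply: PTo_tmpl => i.
  case: i => [|i]; first [exact: Pnil | apply: PTn_cell; do ?apply: PTn_succ; first [exact: PTk | exact: Psz | exact: Pc0]].
Qed.

End OutputPolynomial.

End CookLevin.

Lemma PRP_NP_hard : NP_hard (encoded encode_instance PRP).
Proof.
move=> A L [C [V [p0 [[k [G [iA [iC [M [p1 [injA injC HM]]]]]]] HL]]]].
(* [T] is the running time on the longest certificates allowed. It also suffices for shorter ones,
   as polynomials over [nat] are monotone and a halted machine does not change. *)
pose T n := p1.[n + p0.[n]%R]%R; pose B n := p0.[n]%R.
exists (fun x => output iA iC M (T (size x)) (B (size x)) (onth x)); split.
  apply: (@PT_computable A token (A + token)%type inl inr
    (fun X => map inr (output iA iC M (T (size X)) (B (size X))
       (fun j => letter (ohead (drop j X)))))).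
  - by move=> a b [].
  - by move=> a b [].
  - apply: PTo_output; last by apply: PTn_poly; apply: PTn_size; apply: PT_var.
    apply: PTn_poly; apply: PTn_add; first by apply: PTn_size; apply: PT_var.
    by apply: PTn_poly; apply: PTn_size; apply: PT_var.
  - move=> x; rewrite size_map; congr (map inr (output _ _ _ _ _ _)).
    apply: functional_extensionality => j.
    by elim: x j => [|a x IH] [|j] //=.
move=> x; rewrite output_correct HL; have H y : size y <= B (size x) ->
    V x y <-> (iter (T (size x)) (@tm_step _ _ M) (tm_init M (map iA x) (map iC y))).1 \in tm_accept M.
  move=> sz; have [halt ->] := HM x y.
  have le : p1.[(size x + size y)%N]%R <= T (size x).
    by apply: horner_mono; rewrite leq_add2l.
  rewrite -(subnK le) iterD; set c := iter _ _ (tm_init _ _ _) in halt *.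
  suff -> : iter (T (size x) - p1.[(size x + size y)%N]%R) (@tm_step _ _ M) c = c by [].
  elim: (T _ - _) => //= m ->; move: halt; rewrite /tm_halted /tm_step.
  by case: tm_action.
by split=> -[y sz Vy]; exists y => //; apply/H.
Qed.

Theorem theorem3 : NP_complete (encoded encode_instance PRP).
Proof. exact: conj PRP_in_NP PRP_NP_hard. Qed.
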